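(* Let $\Lambda\subset\mathbb{R}^d$ be a lattice with dual lattice $\Lambda^*$, and let $(X_N)_{N\in\mathbb{N}}$, $X_N=\{\mathbf{x}_1,\dots,\mathbf{x}_N\}\subset\Omega_\Lambda$, be a sequence of point sets which is hyperuniform for large balls. Then for all $w\in\Lambda^*\setminus\{0\}$ $$\lim_{N\to\infty}\frac1N\sum_{k,j=1}^N e^{2\pi i\langle w,\mathbf{x}_j-\mathbf{x}_k\rangle}=0.$$ As a consequence, sequences which are hyperuniform for large balls are uniformly distributed on $\Omega_\Lambda$.
   Context: Let $\Lambda=A\mathbb{Z}^d$ be a lattice in $\mathbb{R}^d$, generated by a nonsingular matrix $A=[v_1,\dots,v_d]$, with fundamental domain $\Omega_\Lambda=\{\sum_{j=1}^d\alpha_jv_j:\alpha_j\in[0,1)\}$ of $\mathbb{R}^d/\Lambda$, co-volume $|\Lambda|=|\det A|$ and dual lattice $\Lambda^*=\{w\in\mathbb{R}^d:\langle w,v\rangle\in\mathbb{Z}\text{ for all }v\in\Lambda\}$. Let $\mu$ be Lebesgue measure on $\Omega_\Lambda$ normalized so that $\mu(\Omega_\Lambda)=1$, and let $\mathrm{diam}\,\Omega_\Lambda$ be the Euclidean diameter. A sequence of point sets $(X_N)_{N\in\mathbb{N}}$ has $X_N=\{\mathbf{x}_1,\dots,\mathbf{x}_N\}\subset\Omega_\Lambda$ with $\#X_N=N$; the points $\mathbf{x}_j=\mathbf{x}_j^{(N)}$ may depend on $N$. Balls on the torus: indicator functions of balls are $\Lambda$-periodized, i.e. for $\mathbf{x},\mathbf{y}\in\mathbb{R}^d$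 and $R\ge 0$ put $\mathbb{1}_{B(\mathbf{x},R)}(\mathbf{y})=\#\{v\in\Lambda:|\mathbf{y}+v-\mathbf{x}|\le R\}$, and $\mathrm{Vol}(B(\mathbf{x},R))=\frac{1}{|\Lambda|}\frac{\pi^{d/2}}{\Gamma(d/2+1)}R^d$ (so this is the $\mu$-mean of $\mathbb{1}_{B(\mathbf{x},R)}$). Uniform distribution: $(X_N)$ is uniformly distributed on $\Omega_\Lambda$ if $\lim_{N\to\infty}\frac1N\sum_{j=1}^N\mathbb{1}_{B(\mathbf{x},R)}(\mathbf{x}_j)=\mathrm{Vol}(B(\mathbf{x},R))$ for all $\mathbf{x}\in\mathbb{R}^d$ and $R\in[0,\frac12\mathrm{diam}\,\Omega_\Lambda]$. Number variance: $V(X_N,R)=\int_{\Omega_\Lambda}\big(\sum_{j=1}^N\mathbb{1}_{B(\mathbf{x},R)}(\mathbf{x}_j)-N\,\mathrm{Vol}(B(\mathbf{x},R))\big)^2d\mu(\mathbf{x})$. $(X_N)$ is hyperuniform for large balls if for every $R\in(0,\frac12\mathrm{diam}\,\Omega_\Lambda)$ one has $V(X_N,R)=o(N)$ as $N\to\infty$. *)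

(* Defs.v *)
From HB Require Import structures.
From mathcomp Require Import all_boot all_order all_algebra.
From mathcomp Require Import all_classical all_reals all_analysis.
From mathcomp Require Import finmap complex.

Set Implicit Arguments.
Unset Strict Implicit.
Unset Printing Implicit Defensive.

Import Order.TTheory GRing.Theory Num.Theory.
Import numFieldNormedType.Exports.

Local Open Scope classical_set_scope.
Local Open Scope ring_scope.

(* R^d is ['cV[R]_d], with the sigma-algebra generated by the d coordinate
   maps, i.e. the product of d copies of the Borel sigma-algebra of R. *)
Section measurable_cV.
Context {R : realType}.
Variable d : nat.

Definition coord (i : 'I_d) (v : 'cV[R]_d) : R := v i ord0.

Let cV_set0 : g_sigma_preimage coord set0.
Proof. exact: sigma_algebra0. Qed.

Let cV_setC A : g_sigma_preimage coord A -> g_sigma_preimage coord (~` A).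
Proof. exact: sigma_algebraC. Qed.

Let cV_bigcup (F : (set 'cV[R]_d)^nat) :
  (forall i, g_sigma_preimage coord (F i)) ->
  g_sigma_preimage coord (\bigcup_i F i).
Proof. exact: sigma_algebra_bigcup. Qed.

HB.instance Definition _ := @isMeasurable.Build default_measure_display
  'cV[R]_d (g_sigma_preimage coord) cV_set0 cV_setC cV_bigcup.

End measurable_cV.

Lemma measurable_coord (R : realType) d (i : 'I_d) :
  measurable_fun [set: 'cV[R]_d] (coord i).
Proof.
move=> _ Y mY; rewrite setTI; apply: sub_sigma_algebra => /=.
rewrite -bigcup_seq/=; exists i => /=; first by rewrite mem_index_enum.
by exists Y => //; rewrite setTI.
Qed.

Lemma measurable_fun_cV dT (T : measurableType dT) (R : realType) d
    (f : T -> 'cV[R]_d) :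
  (forall i, measurable_fun [set: T] (coord i \o f)) ->
  measurable_fun [set: T] f.
Proof.
move=> mf _ Y mY; rewrite setTI.
suff /(_ Y mY) : @g_sigma_preimage _ _ 'cV[R]_d d (@coord R d) `<=`
  [set Z | measurable (f @^-1` Z)] by [].
apply: smallest_sub => /=.
  split => /=.
  - by rewrite preimage_set0.
  - move=> Z mZ; rewrite setTD preimage_setC; exact: measurableC.
  - by move=> F mF; rewrite preimage_bigcup; exact: bigcupT_measurable.
move=> Z; rewrite -bigcup_seq/= => -[i _ [B mB <-]].
by have := mf i measurableT B mB; rewrite !setTI.
Qed.

Section lebesgue_cV.
Context {R : realType}.

Definition cV_cons d (p : R * 'cV[R]_d) : 'cV[R]_d.+1 :=
  col_mx (const_mx p.1 : 'cV[R]_1) p.2.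

Definition cV_uncons d (v : 'cV[R]_d.+1) : R * 'cV[R]_d :=
  (v ord0 ord0, dsubmx (v : 'cV[R]_(1 + d))).

Lemma cV_consK d : cancel (@cV_cons d) (@cV_uncons d).
Proof.
move=> [t v]; rewrite /cV_uncons /cV_cons col_mxKd; congr (_, _).
transitivity (col_mx (const_mx t : 'cV_1) v (lshift d ord0) ord0).
  by congr (col_mx _ _ _ _); exact/val_inj.
by rewrite col_mxEu mxE.
Qed.

Lemma measurable_cV_cons d : measurable_fun setT (@cV_cons d).
Proof.
apply: measurable_fun_cV => i; case: (@split_ordP 1 d i) => j ->.
  have -> : coord (lshift d j) \o @cV_cons d = fst.
    by apply/funext => p /=; rewrite /coord /cV_cons col_mxEu mxE.
  exact: measurable_fst.
have -> : coord (rshift 1 j) \o @cV_cons d = coord j \o snd.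
  by apply/funext => p /=; rewrite /coord /cV_cons col_mxEd.
by apply: measurableT_comp => //; exact: measurable_coord.
Qed.

Lemma measurable_cV_uncons d : measurable_fun setT (@cV_uncons d).
Proof.
apply: measurable_fun_pair; first exact: (measurable_coord ord0).
apply: measurable_fun_cV => i.
have -> : coord i \o (fun v => dsubmx (v : 'cV[R]_(1 + d))) =
    coord (rshift 1 i : 'I_d.+1).
  by apply/funext => v /=; rewrite /coord mxE.
exact: measurable_coord.
Qed.

Section step.
Variables (d : nat) (mu : {sigma_finite_measure set (measurableTypeR R) -> \bar R}).
Variable m : {sigma_finite_measure set 'cV[R]_d -> \bar R}.
Local Open Scope ereal_scope.

Definition cV_step : set 'cV[R]_d.+1 -> \bar R :=
  pushforward (mu \x m) (@cV_cons d).

Let step0 : cV_step set0 = 0.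
Proof. by rewrite /cV_step /pushforward preimage_set0 measure0. Qed.

Let step_ge0 A : 0 <= cV_step A.
Proof. by rewrite /cV_step /pushforward measure_ge0. Qed.

Let step_sigma_additive : semi_sigma_additive cV_step.
Proof.
move=> F mF tF mUF; rewrite /cV_step /pushforward preimage_bigcup.
apply: measure_semi_sigma_additive.
- by move=> n; rewrite -[X in measurable X]setTI; exact: measurable_cV_cons.
- apply/trivIsetP => /= i j _ _ ij; rewrite -preimage_setI.
  by move/trivIsetP : tF => /(_ i j Logic.I Logic.I ij) ->; rewrite preimage_set0.
- rewrite -preimage_bigcup -[X in measurable X]setTI.
  exact: measurable_cV_cons.
Qed.

HB.instance Definition _ := isMeasure.Build _ _ _ cV_step
  step0 step_ge0 step_sigma_additive.

Let step_sigma_finite : sigma_finite setT cV_step.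
Proof.
have /sigma_finiteP[F [TF ndF Foo]] := sigma_finiteT mu.
have /sigma_finiteP[G [TG ndG Goo]] := sigma_finiteT m.
exists (fun n => @cV_uncons d @^-1` (F n `*` G n)).
  apply/esym; rewrite -subTset => v _.
  have [n _ Fn] : (\bigcup_i F i) (cV_uncons v).1 by rewrite -TF.
  have [k _ Gk] : (\bigcup_i G i) (cV_uncons v).2 by rewrite -TG.
  exists (maxn n k) => //; split.
  - by move: Fn; exact/subsetPset/ndF/leq_maxl.
  - by move: Gk; exact/subsetPset/ndG/leq_maxr.
move=> n; have [? ?] := Foo n; have [? ?] := Goo n; split.
  rewrite -[X in measurable X]setTI; apply: measurable_cV_uncons => //.
  exact: measurableX.
rewrite /cV_step /pushforward -comp_preimage.
rewrite (_ : _ \o _ = id) ?preimage_id; last exact/funext/cV_consK.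
by rewrite product_measure1E// lte_mul_pinfty// ge0_fin_numE.
Qed.

HB.instance Definition _ := Measure_isSigmaFinite.Build _ _ _ cV_step
  step_sigma_finite.

End step.

(* d-dimensional Lebesgue measure as the d-fold product of the one-dimensional
   one, up to the identification of R * R^d with R^d.+1. *)
Fixpoint lebesgue_cV d : {sigma_finite_measure set 'cV[R]_d -> \bar R} :=
  match d with
  | 0 => dirac (0 : 'cV[R]_0)
  | d'.+1 => cV_step (@lebesgue_measure R) (lebesgue_cV d')
  end.

End lebesgue_cV.

Section lattice.
Context {R : realType} {d : nat}.
Implicit Types (A : 'M[R]_d) (v w y : 'cV[R]_d).

Definition dot v w : R := \sum_i v i ord0 * w i ord0.

(* The norm of the normedModType structure on ['cV[R]_d] is the sup norm. *)
Definition enorm v : R := Num.sqrt (dot v v).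

Definition lattice A : set 'cV[R]_d :=
  [set A *m map_mx intr m | m in [set: 'cV[int]_d]].

Definition dual_lattice A : set 'cV[R]_d :=
  [set w | forall v, lattice A v -> dot w v \is a Num.int].

Definition covolume A : R := `|\det A|.

Definition fund_domain A : set 'cV[R]_d :=
  [set A *m a | a in [set a : 'cV[R]_d | forall j, 0 <= a j ord0 < 1]].

(* [sup] takes its true value here, since [fund_domain A] is bounded. *)
Definition diam A : R :=
  sup [set enorm (v - w) | v in fund_domain A & w in fund_domain A].

Lemma domain_mass_ge0 A : 0 <= (fine (lebesgue_cV d (fund_domain A)))^-1.
Proof. by rewrite invr_ge0 fine_ge0. Qed.

(* Normalized so that [fund_domain A] has mass 1. *)
Definition domain_measure A : {measure set 'cV[R]_d -> \bar R} :=
  mscale (NngNum (domain_mass_ge0 A)) (lebesgue_cV d).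

Definition ball_points A (x : 'cV[R]_d) (r : R) y : set 'cV[R]_d :=
  [set v | lattice A v /\ enorm (y + v - x) <= r].

(* [fset_set] sends infinite sets to [fset0]; [ball_points A x r y] is finite
   when [A] is invertible. *)
Definition ball_indicator A (x : 'cV[R]_d) (r : R) y : R :=
  #|` fset_set (ball_points A x r y)|%fset%:R.

Definition Gamma (s : R) : R :=
  \int[lebesgue_measure]_(t in `]0, +oo[) (t `^ (s - 1) * expR (- t)).

Definition ball_volume A (r : R) : R :=
  (covolume A)^-1 * (pi `^ (d%:R / 2) / Gamma (d%:R / 2 + 1)) * r ^+ d.

Definition point_sequence := forall N, 'I_N -> 'cV[R]_d.

Definition point_sets A (X : point_sequence) : Prop :=
  forall N, injective (X N) /\ (forall j, fund_domain A (X N j)).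

Definition uniformly_distributed A (X : point_sequence) : Prop :=
  forall (x : 'cV[R]_d) (r : R), 0 <= r <= diam A / 2 ->
    (fun N : nat => N%:R^-1 * \sum_(j < N) ball_indicator A x r (X N j))
      @ \oo --> ball_volume A r.

Definition number_variance A N (x : 'I_N -> 'cV[R]_d) (r : R) : R :=
  \int[domain_measure A]_(y in fund_domain A)
    (\sum_(j < N) ball_indicator A y r (x j) - N%:R * ball_volume A r) ^+ 2.

Definition hyperuniform_large_balls A (X : point_sequence) : Prop :=
  forall r : R, 0 < r < diam A / 2 ->
    (fun N => number_variance A (X N) r : R^o) =o_\oo (fun N => N%:R : R^o).

End lattice.

(* [expi2pi t] is e^(2 pi i t). *)
Definition expi2pi (R : realType) (t : R) : R[i] :=
  Complex (cos (2 * pi * t)) (sin (2 * pi * t)).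

(* Main.v *)
(* Write f_N(y) = #(X_N in B(y,r)) - N Vol(B(y,r)) and test f_N against a
   lattice-periodic g over the fundamental domain. Unfolding the periodized ball
   gives  int f_N g = sum_j int_{B(x_j,r)} g - N Vol(B_r) int g,  and by
   Cauchy-Schwarz this is O(sqrt V(X_N,r)) = o(sqrt N). Three choices of g:
   - g = 1 shows that [ball_volume], a formula involving Gamma, is the true
     normalized volume of small balls (otherwise the hypothesis would fail), and
     scaling extends this to all radii;
   - g = cos, sin (2 pi <w,y>), with r so small that int_{B_r} cos (2 pi <w,y>) > 0,
     bounds the exponential sums;
   - g = periodized indicator of B(x, R + r) or B(x, R - r) sandwiches the count
     of X_N in B(x,R), since 1_{B(x,R)}(x_j) <= 1_{B(x,R+r)}(y) for y in B(x_j,r).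
     Then r tends to 0, so no Weyl criterion is needed, and R = diam/2 is covered. *)
Require Import Defs.
From mathcomp Require Import all_boot all_order all_algebra.
From mathcomp Require Import all_classical all_reals all_analysis.
From mathcomp Require Import measurable_realfun.
From mathcomp Require Import finmap complex zify.
From mathcomp Require Import ring lra.
Import Defs.
Set Implicit Arguments.
Unset Strict Implicit.
Unset Printing Implicit Defensive.
Import Order.TTheory GRing.Theory Num.Theory.
Import numFieldNormedType.Exports.
Local Open Scope classical_set_scope.
Local Open Scope ring_scope.

(** * Affine changes of variable for Lebesgue measure on R^d *)

Section affine_change.
Context {R : realType}.
Local Open Scope ereal_scope.

(** Packages a multiple of an image measure as a measure, so that the uniqueness theorems for
    Lebesgue and product measures apply to it. *)
Lemma scaled_pushforward d1 d2 (T1 : measurableType d1) (T2 : measurableType d2)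
    (mu : {measure set T1 -> \bar R}) (f : T1 -> T2) (c : R) :
  (0 <= c)%R -> measurable_fun [set: T1] f ->
  exists m : {measure set T2 -> \bar R},
    forall A, m A = c%:E * mu (f @^-1` A).
Proof.
move=> c0 mf.
exists (mscale (NngNum c0)
  (measure_function_pushforward__canonical__measure_function_Measure mu mf)).
by [].
Qed.

(** Lebesgue measure is determined by half-open intervals, and the preimage of such an interval is
    again one, shorter by the factor [c]. *)
Lemma lebesgue_measure_affine (c b : R) (E : set (measurableTypeR R)) :
  (0 < c)%R -> measurable E ->
  lebesgue_measure E =
  c%:E * lebesgue_measure ((fun t : R => (c * t + b)%R) @^-1` E).
Proof.
move=> c0 mE.
have mf : measurable_fun [set: measurableTypeR R]
    (fun t : measurableTypeR R => (c * t + b)%R : measurableTypeR R).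
  by apply: measurable_funD => //; exact: mulrl_measurable.
have [m mP] := scaled_pushforward (@lebesgue_measure R) (ltW c0) mf.
rewrite -mP; apply: lebesgue_measure_unique => // _ [[x y] _ <-] /=.
rewrite mP; set S := (X in _ * lebesgue_measure X).
have -> : S = [set` `](x - b)%R / c, (y - b)%R / c]%R].
  apply/seteqP; split => t; rewrite /S /= !in_itv /=;
    by rewrite ltr_pdivrMr// ler_pdivlMr// ltrBlDr lerBrDr [(c * _)%R]mulrC.
rewrite !lebesgue_measure_itv /= !lte_fin ltr_pM2r ?invr_gt0// ltrD2r.
case: ifPn => _; last by rewrite mule0.
rewrite -!EFinD -EFinM; congr _%:E.
by field; rewrite gt_eqF.
Qed.

Lemma measurable_cV_affine d (c : R) (b : 'cV[R]_d) :
  measurable_fun [set: 'cV[R]_d] (fun v => (c *: v + b)%R).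
Proof.
apply: measurable_fun_cV => i.
rewrite (_ : coord i \o _ = (fun p => (c * coord i p + coord i b)%R)); last first.
  by apply/funext => p; rewrite /= /coord !mxE.
apply: measurable_funD => //.
by apply: (measurableT_comp (mulrl_measurable _)) => /=; exact: measurable_coord.
Qed.

Lemma cV_unconsK d : cancel (@cV_uncons R d) (@cV_cons R d).
Proof.
move=> v; rewrite /cV_cons /cV_uncons /= -[RHS](@vsubmxK _ 1 d).
apply: (congr1 (fun x : 'cV_1 => col_mx x (dsubmx (v : 'cV_(1 + d))))).
apply/matrixP => i j; rewrite !mxE (ord1 j).
by congr (v _ _); apply/val_inj; rewrite /= (ord1 i).
Qed.

Lemma cV_cons_affine d (c : R) (b : 'cV[R]_d.+1) (p : R * 'cV[R]_d) :
  cV_cons ((c * p.1 + b ord0 ord0)%R,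
    (c *: p.2 + dsubmx (b : 'cV[R]_(1 + d)))%R) = (c *: cV_cons p + b)%R.
Proof.
have := add_col_mx (c *: const_mx p.1 : 'cV_1) (c *: p.2)
  (const_mx (b ord0 ord0)) (dsubmx (b : 'cV[R]_(1 + d))).
rewrite -scale_col_mx => H; rewrite -[b in RHS]cV_unconsK.
refine (etrans _ (esym H)).
apply: (congr1 (fun x : 'cV_1 => col_mx x _)).
by apply/matrixP => i j; rewrite !mxE.
Qed.

(** Induction on [d]. The product measure is determined by rectangles; on these the line contributes
    one factor [c] and the induction hypothesis contributes [c ^+ d]. *)
Lemma lebesgue_cV_affine d (c : R) (b : 'cV[R]_d) (E : set 'cV[R]_d) :
  (0 < c)%R -> measurable E ->
  lebesgue_cV d E =
  (c ^+ d)%:E * lebesgue_cV d ((fun v => (c *: v + b)%R) @^-1` E).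
Proof.
move=> c0; elim: d b E => [|d IH] b E mE.
  rewrite expr0 mul1e; congr (_ _); apply/funext => v.
  by congr (E _); rewrite !flatmx0.
pose b0 := b ord0 ord0.
pose b' : 'cV[R]_d := dsubmx (b : 'cV[R]_(1 + d)).
pose phi (p : measurableTypeR R * 'cV[R]_d) : measurableTypeR R * 'cV[R]_d :=
  ((c * p.1 + b0)%R, (c *: p.2 + b')%R).
have mphi : measurable_fun setT phi.
  apply: measurable_fun_pair.
    apply: measurable_funD => //.
    apply: (measurableT_comp (mulrl_measurable _)); exact: measurable_fst.
  by apply: (measurableT_comp (measurable_cV_affine _ _)); exact: measurable_snd.
have cd0 : (0 <= c ^+ d.+1)%R by rewrite exprn_ge0// ltW.
have [m' m'P] := scaled_pushforward
  ((@lebesgue_measure R) \x (lebesgue_cV d))%E cd0 mphi.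
have mE' : measurable (@cV_cons R d @^-1` E).
  by rewrite -[X in measurable X]setTI; exact: measurable_cV_cons.
have -> : lebesgue_cV d.+1 E =
    ((@lebesgue_measure R) \x (lebesgue_cV d))%E (@cV_cons R d @^-1` E) by [].
rewrite (@product_measure_unique _ _ _ _ _ _ _ m')//.
  rewrite m'P; congr (_ * _).
  rewrite /= /cV_step /pushforward; congr (_ _).
  by apply/funext => -[t v]; rewrite /preimage /= cV_cons_affine.
move=> A B mA mB; rewrite m'P.
pose B' : set 'cV[R]_d := (fun v => (c *: v + b')%R) @^-1` B.
pose A' : set (measurableTypeR R) := (fun t : R => (c * t + b0)%R) @^-1` A.
have -> : phi @^-1` (A `*` B) = A' `*` B' by [].
have mA' : measurable A'.
  rewrite -[X in measurable X]setTI; apply: (_ : measurable_fun _ _) => //.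
  by apply: measurable_funD => //; exact: mulrl_measurable.
have mB' : measurable B'.
  rewrite -[X in measurable X]setTI; apply: (_ : measurable_fun _ _) => //.
  exact: measurable_cV_affine.
transitivity ((c ^+ d.+1)%:E * (lebesgue_measure A' * lebesgue_cV d B')).
  by congr (_ * _); exact: product_measure1E.
rewrite exprS EFinM muleACA; congr (_ * _).
  by rewrite -lebesgue_measure_affine.
by rewrite -IH.
Qed.
End affine_change.

Lemma Rintegral_cV_shift (R : realType) d (b : 'cV[R]_d) (f : 'cV[R]_d -> R) :
  measurable_fun [set: 'cV[R]_d] f ->
  (lebesgue_cV d).-integrable setT (EFin \o (fun v => f (v + b))) ->
  \int[lebesgue_cV d]_v f (v + b) = \int[lebesgue_cV d]_v f v.
Proof.
move=> mf intf.
have mphi : measurable_fun setT (fun v : 'cV[R]_d => v + b).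
  have := measurable_cV_affine 1 b.
  by under eq_fun do rewrite scale1r.
rewrite /Rintegral; congr fine.
rewrite [RHS](@eq_measure_integral _ _ _ _
  (measure_function_pushforward__canonical__measure_function_Measure
    (lebesgue_cV d) mphi)).
  rewrite integral_pushforward//=; exact/measurable_EFinP.
move=> E mE _; apply: etrans (lebesgue_cV_affine b (@ltr01 R) mE) _.
rewrite expr1n mul1e; congr (lebesgue_cV d _); apply/funext => v /=.
by rewrite /preimage /= scale1r.
Qed.

(** * Euclidean norm and balls *)

Section euclidean_norm.
Context {R : realType} {d : nat}.
Implicit Types v w : 'cV[R]_d.

Lemma dotDl u v w : dot (u + v) w = dot u w + dot v w.
Proof. by rewrite -big_split /=; apply: eq_bigr => i _; rewrite mxE mulrDl. Qed.

Lemma dotC v w : dot v w = dot w v.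
Proof. by apply: eq_bigr => i _; rewrite mulrC. Qed.

Lemma dotZl c v w : dot (c *: v) w = c * dot v w.
Proof. by rewrite /dot mulr_sumr; apply: eq_bigr => i _; rewrite mxE mulrA. Qed.

Lemma dotDr u v w : dot u (v + w) = dot u v + dot u w.
Proof. by rewrite dotC dotDl !(dotC u). Qed.

Lemma dotZr c v w : dot v (c *: w) = c * dot v w.
Proof. by rewrite dotC dotZl dotC. Qed.

Lemma dotNr v w : dot v (- w) = - dot v w.
Proof. by rewrite -scaleN1r dotZr mulN1r. Qed.

Lemma dotNl v w : dot (- v) w = - dot v w.
Proof. by rewrite dotC dotNr dotC. Qed.

Lemma dot_ge0 v : 0 <= dot v v.
Proof. by apply: sumr_ge0 => i _; rewrite -expr2 sqr_ge0. Qed.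

Lemma enorm_ge0 v : 0 <= enorm v.
Proof. exact: sqrtr_ge0. Qed.

Lemma sqr_enorm v : enorm v ^+ 2 = dot v v.
Proof. by rewrite sqr_sqrtr// dot_ge0. Qed.

Lemma enormZ c v : enorm (c *: v) = `|c| * enorm v.
Proof. by rewrite /enorm dotZl dotZr mulrA -expr2 sqrtrM ?sqr_ge0// sqrtr_sqr. Qed.

Lemma enormN v : enorm (- v) = enorm v.
Proof. by rewrite -scaleN1r enormZ normrN1 mul1r. Qed.

Lemma enormBC v w : enorm (v - w) = enorm (w - v).
Proof. by rewrite -enormN opprB. Qed.

Lemma coord_le_enorm v i : `|v i ord0| <= enorm v.
Proof.
rewrite -ler_sqr ?nnegrE ?enorm_ge0// sqr_enorm -normrX ger0_norm ?sqr_ge0//.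
rewrite /dot (bigD1 i)//= -expr2 lerDl sumr_ge0// => j _.
by rewrite -expr2 sqr_ge0.
Qed.

Lemma enorm_gt0 v : v != 0 -> 0 < enorm v.
Proof.
move=> v0; rewrite lt_neqAle enorm_ge0 andbT eq_sym; apply: contra v0 => /eqP v0.
apply/eqP/matrixP => i j; rewrite (ord1 j) mxE; apply/eqP.
by rewrite -normr_le0 -v0 coord_le_enorm.
Qed.

(** Expanding the square norm of [enorm w *: v - enorm v *: w] gives [2ab(ab - dot v w) >= 0] with
    [a], [b] the two norms; dividing by [ab] requires the zero vectors to be treated first. *)
Lemma dot_le_enorm v w : dot v w <= enorm v * enorm w.
Proof.
have [->|/enorm_gt0 v0] := eqVneq v 0.
  by rewrite -(scale0r (0 : 'cV[R]_d)) dotZl enormZ normr0 !mul0r.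
have := dot_ge0 (enorm w *: v - enorm v *: w).
have [->|/enorm_gt0 w0] := eqVneq w 0.
  by rewrite dotC -(scale0r (0 : 'cV[R]_d)) dotZl enormZ normr0 !mul0r mulr0.
rewrite dotDl !dotDr !(dotNl, dotNr) !(dotZl, dotZr) -!sqr_enorm (dotC w v).
set a := enorm v in v0 *; set b := enorm w in w0 * => H.
have : 0 <= 2 * (a * b) * (a * b - dot v w) by apply: (le_trans H); lra.
by rewrite pmulr_rge0 ?subr_ge0// !mulr_gt0.
Qed.

Lemma enormD v w : enorm (v + w) <= enorm v + enorm w.
Proof.
rewrite -ler_sqr ?nnegrE ?addr_ge0 ?enorm_ge0// sqr_enorm dotDl !dotDr.
rewrite (dotC w v) -!sqr_enorm; have := dot_le_enorm v w.
by nra.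
Qed.

Lemma enorm_le_coord v M : (forall i, `|v i ord0| <= M) -> enorm v <= M * d%:R.
Proof.
case: d v => [|n] v vM.
  by rewrite (flatmx0 v) mulr0 -(scale0r (0 : 'cV[R]_0)) /enorm /dot big_ord0 sqrtr0.
have M0 : 0 <= M by exact: le_trans (normr_ge0 _) (vM ord0).
rewrite /enorm -[leRHS]ger0_norm ?mulr_ge0// -sqrtr_sqr ler_wsqrtr//.
apply: (@le_trans _ _ (\sum_(i < n.+1) M ^+ 2)).
  by apply: ler_sum => i _; rewrite -expr2 -real_normK ?num_real// lerXn2r.
rewrite sumr_const card_ord exprMn -[leLHS]mulr_natr ler_wpM2l ?sqr_ge0//.
by rewrite expr2 -natrM ler_nat leq_pmulr.
Qed.

Lemma measurable_fun_dot w : measurable_fun [set: 'cV[R]_d] (dot w).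
Proof.
apply: measurable_sum => i; apply: measurable_funM => //.
exact: (measurable_coord i).
Qed.

Lemma measurable_enorm : measurable_fun [set: 'cV[R]_d] enorm.
Proof.
have mS : measurable_fun [set: R] (@Num.sqrt R).
  by apply: continuous_measurable_fun; exact: sqrt_continuous.
apply: (measurableT_comp mS).
by apply: measurable_sum => i; apply: measurable_funM;
  exact: (measurable_coord i).
Qed.

End euclidean_norm.

(** * Linear maps: measurability and operator bounds *)

Section linear_maps.
Context {R : realType} {d : nat}.

Lemma measurable_mulmx (B : 'M[R]_d) :
  measurable_fun [set: 'cV[R]_d] (fun v => B *m v).
Proof.
apply: measurable_fun_cV => i.
rewrite (_ : _ \o _ = dot (row i B)^T); first exact: measurable_fun_dot.
by apply/funext => v; rewrite /coord /dot /= mxE; apply: eq_bigr => j _; rewrite !mxE.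
Qed.

Lemma enorm_mulmx_bound (B : 'M[R]_d) :
  exists2 C, 0 <= C & forall v, enorm (B *m v) <= C * enorm v.
Proof.
pose C := \sum_(i < d) enorm (row i B)^T.
have C0 : 0 <= C by apply: sumr_ge0 => i _; exact: enorm_ge0.
exists (C * d%:R); first by rewrite mulr_ge0.
move=> v; rewrite mulrAC; apply: enorm_le_coord => i.
have -> : (B *m v) i ord0 = dot (row i B)^T v.
  by rewrite /dot /= mxE; apply: eq_bigr => j _; rewrite !mxE.
apply: (@le_trans _ _ (enorm (row i B)^T * enorm v)).
  rewrite ler_norml dot_le_enorm andbT lerNl -dotNr.
  by rewrite (le_trans (dot_le_enorm _ _))// enormN.
rewrite ler_wpM2r ?enorm_ge0// /C (bigD1 i)//= lerDl sumr_ge0// => j _.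
exact: enorm_ge0.
Qed.

End linear_maps.

(** * Cubes and Euclidean balls: volume, scaling, positivity *)

Section balls.
Context {R : realType}.

(** Balls of the sup norm. The product structure gives their volume directly; larger cubes make
    bounded sets finite in measure, smaller ones make balls positive in measure. *)
Definition cube d (M : R) : set 'cV[R]_d := [set v | forall i, `|v i ord0| <= M].

Lemma measurable_cube d M : measurable (@cube d M).
Proof.
rewrite (_ : cube _ = \big[setI/setT]_(i < d) [set v | `|coord i v| <= M]).
  apply: bigsetI_measurable => i _.
  rewrite -[X in measurable X]setTI; apply: measurable_fun_ler => //.
  by apply: measurableT_comp => //; exact: measurable_coord.
rewrite -bigcap_seq; apply/seteqP; split => v /= vM i.
  by move=> _; exact: vM.
by apply: vM; rewrite /= mem_index_enum.
Qed.

Lemma cV_consEl d (t : R) (v : 'cV[R]_d) (k : 'I_1) :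
  cV_cons (t, v) (lshift d k) ord0 = t.
Proof. by apply: (etrans (@col_mxEu R 1 d 1 (const_mx t) v k ord0)); rewrite mxE. Qed.

Lemma cV_consEr d (t : R) (v : 'cV[R]_d) k :
  cV_cons (t, v) (@rshift 1 d k) ord0 = v k ord0.
Proof. exact: (@col_mxEd R 1 d 1 (const_mx t) v k ord0). Qed.

Lemma lebesgue_cV_cube d M : 0 <= M -> lebesgue_cV d (cube M) = ((2 * M) ^+ d)%:E.
Proof.
move=> M0; elim: d => [|d IH].
  by rewrite /= diracE mem_set// => -[].
transitivity (((@lebesgue_measure R) \x (lebesgue_cV d))
  ([set` `[- M, M]%R] `*` @cube d M))%E.
  rewrite /= /cV_step /pushforward; congr (_ _).
  apply/seteqP; split => -[t v] /=.
    move=> H; split; rewrite /= ?in_itv/=.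
      by have := H (lshift d (ord0 : 'I_1)); rewrite cV_consEl ler_norml.
    by move=> i; have := H (@rshift 1 d i); rewrite cV_consEr.
  move=> [/=]; rewrite in_itv/= -ler_norml => tM vM i.
  case: (@split_ordP 1 d i) => k ->; rewrite ?cV_consEl ?cV_consEr//.
rewrite (product_measure1E (@lebesgue_measure R) (lebesgue_cV d)) //; last first.
  exact: measurable_cube.
have IM : lebesgue_measure [set` `[- M, M]%R] = (2 * M)%:E.
  rewrite lebesgue_measure_itv /= lte_fin.
  case: ltP => [_|MM]; first by rewrite -EFinD; congr _%:E; lra.
  by have -> : M = 0; [lra|rewrite mulr0].
by rewrite exprS EFinM -IM -IH.
Qed.

Definition eball d (x : 'cV[R]_d) r : set 'cV[R]_d := [set v | enorm (v - x) <= r].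

Lemma eball_bounded d (x : 'cV[R]_d) r :
  eball x r `<=` [set v | enorm v <= r + enorm x].
Proof.
move=> v; rewrite /eball /= => vr; rewrite -[v](subrK x).
by rewrite (le_trans (enormD _ _))// lerD2r.
Qed.

Lemma eball0_bounded d (r : R) :
  eball (0 : 'cV[R]_d) r `<=` [set v | enorm v <= r].
Proof. by move=> y; rewrite /eball /= subr0. Qed.

Lemma measurable_eball d (x : 'cV[R]_d) r : measurable (eball x r).
Proof.
rewrite -[X in measurable X]setTI; apply: measurable_fun_ler => //.
apply: measurableT_comp; first exact: measurable_enorm.
have := measurable_cV_affine 1 (- x).
by under eq_fun do rewrite scale1r.
Qed.

Lemma lebesgue_cV_eballE d (x : 'cV[R]_d) r :
  lebesgue_cV d (eball x r) = lebesgue_cV d (eball 0 r).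
Proof.
rewrite (lebesgue_cV_affine x (@ltr01 R) (measurable_eball x r)) expr1n mul1e.
congr (_ _); apply/funext => v; rewrite /eball /preimage /=.
by rewrite scale1r addrK subr0.
Qed.

Lemma lebesgue_cV_eball_scale d r : 0 < r ->
  lebesgue_cV d (eball 0 r) = ((r ^+ d)%:E * lebesgue_cV d (eball 0%R 1%R))%E.
Proof.
move=> r0; rewrite (lebesgue_cV_affine 0 r0 (measurable_eball 0 r)).
congr (_ * lebesgue_cV d _)%E; apply/funext => v; rewrite /eball /preimage /=.
by rewrite addr0 !subr0 enormZ gtr0_norm// ger_pMr.
Qed.

Lemma lebesgue_cV_le d (E F : set 'cV[R]_d) : measurable E -> measurable F ->
  E `<=` F -> (lebesgue_cV d E <= lebesgue_cV d F)%E.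
Proof. by move=> mE mF; apply: le_measure; exact: mem_set. Qed.

Lemma lebesgue_cV_bounded_lty d (E : set 'cV[R]_d) M :
  measurable E -> E `<=` [set v | enorm v <= M] -> (lebesgue_cV d E < +oo)%E.
Proof.
move=> mE EM; apply: (@le_lt_trans _ _ (lebesgue_cV d (cube `|M|))); last first.
  by rewrite lebesgue_cV_cube// ltry.
apply: (lebesgue_cV_le mE (measurable_cube _)).
move=> v /EM /= vM i; apply: (le_trans (coord_le_enorm v i)).
exact: le_trans vM (ler_norm _).
Qed.

Lemma lebesgue_cV_eball_gt0 d r : 0 < r -> (0 < lebesgue_cV d (eball 0 r))%E.
Proof.
(* A cube of half-side [M] lies in the ball of radius [M * d]; dividing by [d.+1] also covers
   [d = 0]. *)
move=> r0; have dr0 : 0 < r / d.+1%:R by rewrite divr_gt0.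
apply: (@lt_le_trans _ _ (lebesgue_cV d (cube (r / d.+1%:R)))).
  by rewrite lebesgue_cV_cube ?ltW// lte_fin exprn_gt0// mulr_gt0.
apply: (lebesgue_cV_le (measurable_cube _) (measurable_eball _ _)).
move=> v /enorm_le_coord; rewrite /eball /= subr0 => /le_trans; apply.
by rewrite -mulrA ger_pMr// mulrC ler_pdivrMr// mul1r ler_nat.
Qed.

End balls.

(** * Integration of locally bounded functions *)

Section locally_bounded.
Context {R : realType} {d : nat}.
Local Notation V := 'cV[R]_d.
Local Notation lam := (@lebesgue_cV R d).
Implicit Types (f g q : V -> R).

(** The class of all integrands below: stable under sums, products and translations, integrable over
    bounded sets, and wide enough for lattice-periodic functions, which have no decay. *)
Definition locb g := measurable_fun [set: V] g /\
  forall M, exists C, forall y, enorm y <= M -> `|g y| <= C.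

Definition bounded_supp q := exists M, forall y, q y != 0 -> enorm y <= M.

Lemma locb_cst c : locb (fun=> c).
Proof. by split=> // M; exists `|c|. Qed.

Lemma locbD f g : locb f -> locb g -> locb (fun y => f y + g y).
Proof.
move=> [mf bf] [mg bg]; split; first exact: measurable_funD.
move=> M; have [C fC] := bf M; have [C' gC] := bg M.
by exists (C + C') => y yM; rewrite (le_trans (ler_normD _ _))// lerD ?fC ?gC.
Qed.

Lemma locbM f g : locb f -> locb g -> locb (fun y => f y * g y).
Proof.
move=> [mf bf] [mg bg]; split; first exact: measurable_funM.
move=> M; have [C fC] := bf M; have [C' gC] := bg M.
by exists (C * C') => y yM; rewrite normrM ler_pM ?fC ?gC.
Qed.

Lemma locb_sum I (s : seq I) (F : I -> V -> R) :
  (forall i, locb (F i)) -> locb (fun y => \sum_(i <- s) F i y).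
Proof.
move=> HF; elim: s => [|i s IH].
  by under eq_fun do rewrite big_nil; exact: locb_cst.
by under eq_fun do rewrite big_cons; exact: locbD.
Qed.

Lemma locb_indic (E : set V) : measurable E -> locb (\1_E : V -> R).
Proof.
move=> mE; split; first exact: measurable_indic.
by move=> M; exists 1 => y _; rewrite indicE; case: (_ \in _); rewrite ?normr1 ?normr0.
Qed.

Lemma locb_shift b g : locb g -> locb (fun y => g (y + b)).
Proof.
move=> [mg bg]; split.
  apply: measurableT_comp => //; have := measurable_cV_affine 1 b.
  by under eq_fun do rewrite scale1r.
move=> M; have [C gC] := bg (M + enorm b); exists C => y yM.
by apply: gC; rewrite (le_trans (enormD _ _))// lerD2r.
Qed.

Lemma integrable_locb (E : set V) M g : measurable E ->
  E `<=` [set v | enorm v <= M] -> locb g -> lam.-integrable E (EFin \o g).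
Proof.
move=> mE EM [mg /(_ M)[C gC]]; apply: measurable_bounded_integrable => //.
- exact: lebesgue_cV_bounded_lty EM.
- exact: measurable_funTS.
- exists C; split; first exact: num_real.
  by move=> x Cx y /EM yM /=; apply: le_trans (ltW Cx); exact: gC.
Qed.

Lemma integrable_supp q : locb q -> bounded_supp q ->
  lam.-integrable setT (EFin \o q).
Proof.
move=> bq [M qM].
have mE : measurable (eball (0 : V) M) by exact: measurable_eball.
have -> : EFin \o q = (EFin \o q) \_ (eball (0 : V) M).
  apply/funext => y; rewrite patchE; case: ifPn => // /negP yM.
  apply/eqP; rewrite /= eqe; apply/negP => /negP qy.
  by apply/yM/mem_set; rewrite /eball /= subr0; exact: qM.
apply: (iffLR (integrable_mkcond _ mE)).
 apply: (@integrable_locb _ M _ mE _ bq).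
by move=> y; rewrite /eball /= subr0.
Qed.

Lemma supp_indicM (E : set V) M g : E `<=` [set v | enorm v <= M] ->
  bounded_supp (fun y => \1_E y * g y).
Proof.
move=> EM; exists M => y; rewrite indicE; case: (boolP (y \in E)) => [/set_mem/EM//|_].
by rewrite mul0r eqxx.
Qed.

Lemma Rintegral_indicM (E : set V) g :
  \int[lam]_(y in E) g y = \int[lam]_y (\1_E y * g y).
Proof.
rewrite Rintegral_mkcond; apply: eq_Rintegral => y _.
by rewrite patchE indicE; case: ifP => _; rewrite ?mul1r ?mul0r.
Qed.

Lemma Rintegral_sum dT (T : measurableType dT) (mu : {measure set T -> \bar R})
    (E : set T) I (s : seq I) (F : I -> T -> R) : measurable E ->
  (forall i, mu.-integrable E (EFin \o F i)) ->
  \int[mu]_(y in E) (\sum_(i <- s) F i y) = \sum_(i <- s) \int[mu]_(y in E) F i y.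
Proof.
move=> mE HF; elim: s => [|i s IH].
  rewrite big_nil; under eq_Rintegral do rewrite big_nil.
  by rewrite Rintegral_cst// mul0r.
rewrite big_cons -IH; under eq_Rintegral do rewrite big_cons.
rewrite RintegralD//.
rewrite (_ : _ \o _ = (fun y => \sum_(j <- s) (EFin \o F j) y)%E).
  exact: integrable_sum.
by apply/funext => y; rewrite /= sumEFin.
Qed.

End locally_bounded.

(** * Lattice points and the fundamental domain *)

Section lattice_points.
Context {R : realType} {d : nat} (A : 'M[R]_d).
Hypothesis uA : A \in unitmx.
Local Notation V := 'cV[R]_d.

(** Lattice points indexed by their integer coordinates, so that sums over the lattice become sums
    over lists of integer vectors. *)
Definition lpt (m : 'cV[int]_d) : V := A *m map_mx intr m.

Lemma lptD m n : lpt (m + n) = lpt m + lpt n.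
Proof. by rewrite /lpt map_mxD mulmxDr. Qed.

Lemma lptN m : lpt (- m) = - lpt m.
Proof. by rewrite /lpt map_mxN mulmxN. Qed.

Lemma lpt_inj : injective lpt.
Proof.
move=> m n /(congr1 (mulmx (invmx A))); rewrite /lpt !mulKmx// => /matrixP mn.
by apply/matrixP => i j; have := mn i j; rewrite !mxE => /intr_inj.
Qed.

(** Replaces infinite lattice sums by finite ones: a list may contain further vectors, whose terms
    vanish in the sums considered. *)
Definition covers M (s : seq 'cV[int]_d) :=
  forall m, enorm (lpt m) <= M -> m \in s.

Lemma covers_exists M : exists2 s, uniq s & covers M s.
Proof.
have [C C0 HC] := enorm_mulmx_bound (invmx A).
(* Applying [invmx A] to a lattice point of norm at most [M] bounds its integer coordinates by
   [C * |M|]; [F] enumerates the box from [-K] to [K]. *)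
pose K := Num.truncn (C * `|M|).
pose F (f : {ffun 'I_d -> 'I_(K + K).+1}) : 'cV[int]_d :=
  \col_i ((f i)%:Z - K%:Z).
exists (undup [seq F f | f <- enum {ffun 'I_d -> 'I_(K + K).+1}]).
  exact: undup_uniq.
move=> m mM; rewrite mem_undup.
have mK i : (`|m i ord0| <= K)%N.
  have : `|(m i ord0)%:~R| <= C * `|M| :> R.
    have -> : (m i ord0)%:~R = (invmx A *m lpt m) i ord0 :> R.
      by rewrite /lpt mulKmx// mxE.
    apply: le_trans (coord_le_enorm _ _) _; apply: le_trans (HC _) _.
    by rewrite ler_wpM2l// (le_trans mM)// ler_norm.
  rewrite -intr_norm -abszE.
  by move=> H; rewrite truncn_ge_nat// mulr_ge0.
apply/mapP; exists [ffun i => inord (absz (m i ord0 + K%:Z))].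
  by rewrite mem_enum.
apply/matrixP => i j; rewrite (ord1 j) !mxE ffunE.
move: (m i ord0) (mK i) => z zK.
rewrite inordK; lia.
Qed.

Lemma coversS M M' s : M <= M' -> covers M' s -> covers M s.
Proof. by move=> MM s' m mM; apply: s'; exact: le_trans MM. Qed.

Lemma covers_opp M s : covers M s -> covers M (map -%R s).
Proof.
move=> cs m mM; apply/mapP; exists (- m); rewrite ?opprK//.
by apply: cs; rewrite lptN enormN.
Qed.

Lemma covers_add M n s : covers (M + enorm (lpt n)) s -> covers M (map (+%R^~ n) s).
Proof.
move=> cs m mM; apply/mapP; exists (m - n); rewrite ?subrK//.
apply: cs; rewrite lptD lptN (le_trans (enormD _ _))// enormN.
exact: lerD.
Qed.

Lemma fund_domainE (y : V) :
  fund_domain A y <-> forall j, 0 <= (invmx A *m y) j ord0 < 1.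
Proof.
split; first by move=> [a aP <-] j; rewrite mulKmx.
by move=> H; exists (invmx A *m y) => //; rewrite mulKVmx.
Qed.

(** The tiling property: in the basis of the lattice, subtracting [m] leaves coordinates in [[0, 1)]
    exactly when [m] collects the integer parts. *)
Lemma fund_domain_shift (y : V) m :
  fund_domain A (y - lpt m) <-> m = map_mx Num.floor (invmx A *m y).
Proof.
rewrite fund_domainE mulmxBr /lpt mulKmx//; split.
  move=> H; apply/matrixP => i j; rewrite (ord1 j) mxE; apply/esym.
  have := H i; rewrite !mxE => /andP[h1 h2]; apply: floor_def.
  by rewrite intrD -subr_ge0 h1 /= -ltrBlDl.
move=> -> j; rewrite !mxE.
set x := \sum_(_ < _) _.
have /andP[h1 h2] := floor_itv x.
by rewrite subr_ge0 h1 ltrBlDl -[X in _ + X]/(1%:~R) -intrD.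
Qed.

Lemma fund_domain_bounded :
  exists2 M, 0 <= M & fund_domain A `<=` [set v | enorm v <= M].
Proof.
have [C C0 HC] := enorm_mulmx_bound A.
exists (C * d%:R) => [|_ [a aP <-] /=]; first by rewrite mulr_ge0.
apply: le_trans (HC a) _; rewrite ler_wpM2l//.
rewrite -[leRHS]mul1r; apply: enorm_le_coord => i.
by have /andP[a0 a1] := aP i; rewrite ger0_norm// ltW.
Qed.

Lemma measurable_fund_domain : measurable (fund_domain A).
Proof.
rewrite (_ : fund_domain A =
    \bigcap_(i in [set` index_enum 'I_d])
      [set v : V | 0 <= coord i (invmx A *m v) < 1]).
  rewrite bigcap_seq; apply: bigsetI_measurable => i _.
  rewrite -[X in measurable X]setTI; apply: measurable_and => //.
    apply: measurable_fun_ler => //.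
    apply: (measurableT_comp (measurable_coord i)); exact: measurable_mulmx.
  apply: measurable_fun_ltr => //.
  apply: (measurableT_comp (measurable_coord i)); exact: measurable_mulmx.
apply/seteqP; split => v.
  by move=> /fund_domainE H i _; exact: H.
by move=> H; apply/fund_domainE => j; apply: H; rewrite /= mem_index_enum.
Qed.

Lemma eball_indicE (x y : V) r : \1_(eball x r) y = (enorm (y - x) <= r)%R%:R :> R.
Proof.
rewrite indicE; congr (nat_of_bool _)%:R.
by apply/idP/idP => [/set_mem//|?]; exact: mem_set.
Qed.

(** By the triangle inequality every lattice vector counted has norm at most
    [enorm x + enorm y + r]. The set of such vectors is therefore the image of a finite list, on
    which [fset_set] is faithful. *)
Lemma ball_indicatorE (x y : V) r s : uniq s -> covers (enorm x + enorm y + r) s ->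
  ball_indicator A x r y = \sum_(m <- s) \1_(eball x r) (y + lpt m).
Proof.
move=> us cs.
pose P m := enorm (y + lpt m - x) <= r.
have -> : \sum_(m <- s) \1_(eball x r) (y + lpt m) =
    (size [seq m <- s | P m])%:R :> R.
  rewrite size_filter -sum1_count natr_sum [RHS]big_mkcond /=.
  by apply: eq_bigr => m _; rewrite eball_indicE /P; case: ifP.
rewrite /ball_indicator; congr (_%:R).
rewrite (_ : ball_points A x r y = [set` [fset lpt m | m in [seq m <- s | P m]]%fset]).
  rewrite set_fsetK card_imfset ?size_seq_fset//=; last exact: lpt_inj.
  by rewrite undup_id// filter_uniq.
apply/seteqP; split => v.
  move=> [[m _ <-] Pm] /=; apply/imfsetP; exists m => //=.
  rewrite mem_filter {1}/P Pm /=; apply: cs.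
  rewrite -[lpt m](addrK (y - x)) (le_trans (enormD _ _))// addrC enormN.
  apply: lerD; last by rewrite addrC addrAC.
  by rewrite (le_trans (enormD _ _))// enormN addrC.
move=> /imfsetP[m /=]; rewrite mem_filter => /andP[Pm ms] ->; split => //.
by exists m.
Qed.

(** Reflecting the lattice, [m] to [-m], exchanges centre and point. This turns the variance, an
    integral over centres, into one of counts in balls around the sample points. *)
Lemma ball_indicator_sym (x y : V) r : ball_indicator A x r y = ball_indicator A y r x.
Proof.
have [s us cs] := covers_exists (enorm x + enorm y + r).
rewrite (ball_indicatorE us cs) (@ball_indicatorE _ _ _ (map -%R s)); last 2 first.
  by rewrite map_inj_uniq//; exact: oppr_inj.
  by apply: covers_opp; rewrite (addrC (enorm y)).
rewrite big_map; apply: eq_bigr => m _; rewrite !eball_indicE lptN.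
by rewrite -enormN !opprD opprK addrC addrA addrAC.
Qed.

Lemma ball_indicator_ge0 (x y : V) r : 0 <= ball_indicator A x r y.
Proof. exact: ler0n. Qed.

Lemma ball_indicator_periodic (x y : V) r n :
  ball_indicator A x r (y + lpt n) = ball_indicator A x r y.
Proof.
have [s us cs] :=
  covers_exists (enorm x + enorm y + r + enorm (lpt n) + enorm (lpt n)).
rewrite (@ball_indicatorE x y r (map (+%R^~ n) s)); last 2 first.
  by rewrite map_inj_uniq//; exact: addIr.
  apply: covers_add; apply: coversS cs; rewrite lerD2r lerDl enorm_ge0.
  by [].
rewrite (@ball_indicatorE _ _ _ s us); last first.
  apply: coversS cs; have := enormD y (lpt n); have := enorm_ge0 (lpt n); lra.
by rewrite big_map; apply: eq_bigr => m _; rewrite lptD addrAC addrA.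
Qed.

(** On a bounded set a single list serves every [y], so the count is there a finite sum of
    translated ball indicators; measurability is glued along the balls of radius [n]. *)
Lemma locb_ball_indicator (x : V) r : locb (ball_indicator A x r).
Proof.
pose E M := [set y : V | enorm y <= M].
have H M : exists s, {in E M, ball_indicator A x r =1
    fun y => \sum_(m <- s) \1_(eball x r) (y + lpt m)}.
  have [s us cs] := covers_exists (enorm x + M + r).
  exists s => y /set_mem yM; apply: ball_indicatorE us _.
  by apply: coversS cs; rewrite lerD2r lerD2l.
have Hs s : locb (fun y : V => \sum_(m <- s) \1_(eball x r) (y + lpt m)).
  apply: locb_sum => m; have /locb_indic := measurable_eball x r.
  exact: locb_shift.
split; last first.
  move=> M; have [s sE] := H M; have [C HC] := (Hs s).2 M.
  by exists C => y yM; rewrite sE ?HC//; exact: mem_set.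
have -> : [set: V] = \bigcup_(n : nat) E n%:R.
  apply/esym; rewrite -subTset => y _; exists (Num.truncn (enorm y)).+1 => //.
  exact/ltW/truncnS_gt.
have mE n : measurable (E n%:R).
  rewrite -[X in measurable X]setTI; apply: measurable_fun_ler => //.
  exact: measurable_enorm.
apply/measurable_fun_bigcup => // n.
have [s sE] := H n%:R; apply: (eq_measurable_fun _ _ (measurable_funTS (Hs s).1)).
by move=> y yn; rewrite sE.
Qed.

End lattice_points.

Lemma Rintegral_cV_cst (R : realType) d (E : set 'cV[R]_d) (c : R) : measurable E ->
  \int[lebesgue_cV d]_(y in E) c = c * fine (lebesgue_cV d E).
Proof. by move=> mE; rewrite Rintegral_cst. Qed.

(** * Unfolding integrals over the fundamental domain *)

Section unfolding.
Context {R : realType} {d : nat} (A : 'M[R]_d).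
Hypothesis uA : A \in unitmx.
Local Notation V := 'cV[R]_d.
Local Notation lam := (@lebesgue_cV R d).
Local Notation D := (fund_domain A).
Implicit Types (f g q : V -> R).

Definition lat_periodic g := forall y m, g (y + lpt A m) = g y.

(** Exactly one lattice translate of the domain contains [y], and the list contains its index. *)
Lemma fund_domain_indic_sum (y : V) s : uniq s ->
  map_mx Num.floor (invmx A *m y) \in s ->
  \sum_(m <- s) \1_D (y - lpt A m) = 1 :> R.
Proof.
move=> us ys; rewrite (bigD1_seq _ ys us)/= big1 ?addr0.
  by rewrite indicE mem_set//; apply/fund_domain_shift.
move=> m /eqP my; rewrite indicE memNset//.
by move=> /(fund_domain_shift uA).
Qed.

Lemma floor_covered M : exists M', forall s, covers A M' s ->
  forall y : V, enorm y <= M -> map_mx Num.floor (invmx A *m y) \in s.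
Proof.
have [C C0 HC] := fund_domain_bounded A.
exists (M + C) => s cs y yM; apply: cs; set m := map_mx _ _.
have /HC /= : fund_domain A (y - lpt A m) by apply/fund_domain_shift.
move=> yC; rewrite -[lpt A m](subKr y) (le_trans (enormD _ _))// enormN.
exact: lerD.
Qed.

Lemma integrable_fund_domain g : locb g -> lam.-integrable D (EFin \o g).
Proof.
move=> bg; have [M _ DM] := fund_domain_bounded A.
exact: (integrable_locb (measurable_fund_domain uA) DM bg).
Qed.

Lemma bounded_supp_shift b q : bounded_supp q -> bounded_supp (fun y => q (y + b)).
Proof.
move=> [M qM]; exists (M + enorm b) => y /qM yM.
rewrite -[y](addrK b) (le_trans (enormD _ _))// enormN; exact: lerD.
Qed.

(** Translating the term of index [m] by [lpt A m] moves its domain of integration to the translate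
    of [D] by that vector, and these translates tile the space. Bounded support leaves only finitely
    many of them relevant. *)
Lemma unfold_integral q : locb q -> bounded_supp q ->
  exists M, forall s, uniq s -> covers A M s ->
    \int[lam]_(y in D) (\sum_(m <- s) q (y + lpt A m)) = \int[lam]_y q y.
Proof.
move=> bq [M qM]; have [M' HM'] := floor_covered M.
exists M' => s us cs; have mD := measurable_fund_domain uA.
have [C _ DC] := fund_domain_bounded A.
have bF m : locb (fun y : V => \1_D y * q (y + lpt A m)).
  by apply: locbM; [exact: locb_indic|exact: locb_shift].
have iF m : lam.-integrable setT (EFin \o (fun y : V => \1_D y * q (y + lpt A m))).
  by apply: integrable_supp => //; exact: supp_indicM DC.
have iG m : lam.-integrable setT (EFin \o (fun y : V => \1_D (y - lpt A m) * q y)).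
  apply: integrable_supp.
    by apply: locbM => //; exact: (locb_shift _ (locb_indic mD)).
  by exists M => y; rewrite mulf_eq0 negb_or => /andP[_]; exact: qM.
transitivity (\sum_(m <- s) \int[lam]_y (\1_D (y - lpt A m) * q y)).
  rewrite Rintegral_indicM.
  under eq_Rintegral do rewrite mulr_sumr.
  rewrite Rintegral_sum//; apply: eq_bigr => m _.
  rewrite -(@Rintegral_cV_shift _ _ (lpt A m) (fun y => \1_D (y - lpt A m) * q y)).
  - by apply: eq_Rintegral => y _; rewrite addrK.
  - by move/measurable_int: (iG m) => /measurable_EFinP.
  - rewrite (_ : (fun v => _) = (fun y : V => \1_D y * q (y + lpt A m)))//.
    by apply/funext => v; rewrite addrK.
rewrite -Rintegral_sum//; apply: eq_Rintegral => y _.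
(* The tiling identity is available only for [y] of bounded norm, which holds wherever [q] is
   nonzero. *)
rewrite -mulr_suml; have [->|qy] := eqVneq (q y) 0; first by rewrite mulr0.
by rewrite fund_domain_indic_sum ?mul1r//; apply: HM' => //; exact: qM.
Qed.

(** Unfolding applied to the product of the indicator of [eball x r] and [g]; periodicity lets [g]
    leave the lattice sum. *)
Lemma integral_ball_indicator (x : V) r g : locb g -> lat_periodic g ->
  \int[lam]_(y in D) (ball_indicator A x r y * g y) =
  \int[lam]_(y in eball x r) g y.
Proof.
move=> bg pg; have mB := measurable_eball x r.
have BM := @eball_bounded _ _ x r.
have [M HM] := unfold_integral (locbM (locb_indic mB) bg) (supp_indicM g BM).
have [C C0 DC] := fund_domain_bounded A.
(* One list for both purposes, unfolding and expanding the count at every point of [D]; absolute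
   values make the sum dominate either radius, whatever the signs. *)
have [s us cs] := covers_exists uA (`|M| + `|enorm x + C + r|).
rewrite [RHS]Rintegral_indicM -(HM s us); last first.
  by apply: coversS cs; rewrite (le_trans (ler_norm M))// lerDl.
apply: eq_Rintegral => y /set_mem /DC /= yC.
rewrite (@ball_indicatorE _ _ _ uA _ _ _ _ us).
  by rewrite mulr_suml; apply: eq_bigr => m _; rewrite pg.
apply: coversS cs; rewrite -[leLHS]add0r; apply: lerD => //.
by rewrite (le_trans _ (ler_norm _))// lerD2r lerD2l.
Qed.

(** By periodicity [g] has the same integral over [D] and over its translate by [t], whereas the
    substitution [y + t] changes the sign; the integral equals its own opposite. *)
Lemma integral_antiperiodic t g : locb g -> lat_periodic g ->
  (forall y, g (y + t) = - g y) -> \int[lam]_(y in D) g y = 0.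
Proof.
move=> bg pg gt; have mD := measurable_fund_domain uA.
have [C C0 DC] := fund_domain_bounded A.
pose q y := \1_D (y - t) * g y.
have bq : locb q by apply: locbM => //; exact: (locb_shift _ (locb_indic mD)).
have sq : bounded_supp q.
  exists (C + enorm t) => y; rewrite /q indicE; case: (boolP (_ \in _)).
    move=> /set_mem /DC /= H _; rewrite -[y](subrK t) (le_trans (enormD _ _))//.
    by rewrite lerD2r.
  by rewrite mul0r eqxx.
have [M HM] := unfold_integral bq sq.
have [M' HM'] := floor_covered (C + enorm t).
have [s us cs] := covers_exists uA (`|M| + `|M'|).
have E1 : \int[lam]_(y in D) g y = \int[lam]_y q y.
  (* Negating the list turns [y + lpt A m] into [y - lpt A m], the form in which the tiling identity
     is stated. *)
  rewrite -(HM (map -%R s)); last 2 first.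
  - by rewrite map_inj_uniq//; exact: oppr_inj.
  - apply/covers_opp/(coversS _ cs); rewrite (le_trans (ler_norm M))// lerDl.
    exact: normr_ge0.
  apply: eq_Rintegral => y /set_mem /DC /= yC.
  rewrite big_map /q; under eq_bigr do rewrite pg lptN addrAC.
  rewrite -mulr_suml fund_domain_indic_sum ?mul1r//.
  apply: HM'.
    by apply: coversS cs; rewrite (le_trans (ler_norm M'))// lerDr.
  by rewrite (le_trans (enormD _ _))// enormN lerD2r.
have E2 : \int[lam]_y q y = - \int[lam]_(y in D) g y.
  rewrite -(@Rintegral_cV_shift _ _ t q).
  - rewrite [in RHS]Rintegral_indicM -[RHS]mulN1r -RintegralZl//.
      by apply: eq_Rintegral => y _; rewrite /q addrK gt mulrN mulN1r.
    apply: integrable_supp; last exact: supp_indicM DC.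
    by apply: locbM => //; exact: locb_indic.
  - exact: bq.1.
  - by apply: integrable_supp; [exact: locb_shift|exact: bounded_supp_shift].
by move: E2; rewrite -E1; lra.
Qed.

Lemma fund_domain_lty : (lam D < +oo)%E.
Proof.
have [C C0 DC] := fund_domain_bounded A.
exact: lebesgue_cV_bounded_lty (measurable_fund_domain uA) DC.
Qed.

(** If [D] were null, every integral over it would vanish; yet unfolding with [g = 1] makes one of
    them the volume of the unit ball. *)
Lemma fund_domain_gt0 : 0 < fine (lam D).
Proof.
rewrite lt_neqAle fine_ge0// andbT; apply/negP => /eqP/esym D0.
have {}D0 : lam D = 0%E.
  by rewrite -[lam D]fineK ?D0// ge0_fin_numE// fund_domain_lty.
have mD := measurable_fund_domain uA.
have := @integral_ball_indicator 0 1 (cst 1) (locb_cst 1) (fun _ _ => erefl).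
rewrite Rintegral_cst; last exact: measurable_eball.
rewrite /Rintegral null_set_integral//; last first.
  apply/measurable_EFinP/measurable_funTS.
  by apply: (locbM _ (locb_cst 1)).1; exact: locb_ball_indicator.
rewrite mul1r /= => /esym H.
have := lebesgue_cV_eball_gt0 d (@ltr01 R).
rewrite -[X in (_ < X)%E]fineK ?H ?ltxx// ge0_fin_numE//.
apply: (@lebesgue_cV_bounded_lty _ _ _ 1); first exact: measurable_eball.
by move=> y; rewrite /eball /= subr0.
Qed.

End unfolding.

(** * Number variance and test functions *)

Section number_variance_bounds.
Context {R : realType} {d : nat} (A : 'M[R]_d).
Hypothesis uA : A \in unitmx.
Local Notation V := 'cV[R]_d.
Local Notation lam := (@lebesgue_cV R d).
Local Notation D := (fund_domain A).
Local Notation L := (fine (lam D)).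
Implicit Types (f g : V -> R).

(** The integral of [(f - t g) ^+ 2] is nonnegative for each [t]; a suitable [t] gives the bound. *)
Lemma cauchy_schwarz_fund_domain f g C : locb f -> locb g -> 0 < C ->
  (forall y, D y -> `|g y| <= C) ->
  (\int[lam]_(y in D) (f y * g y)) ^+ 2 <=
  C ^+ 2 * L * \int[lam]_(y in D) (f y ^+ 2).
Proof.
move=> bf bg C0 gC.
have L0 := fund_domain_gt0 uA; have mD := measurable_fund_domain uA.
have iD h : locb h -> lam.-integrable D (EFin \o h) by exact: integrable_fund_domain.
set F := \int[lam]_(y in D) (f y ^+ 2).
set I := \int[lam]_(y in D) (f y * g y).
pose Q := \int[lam]_(y in D) (g y ^+ 2).
pose G := C ^+ 2 * L; have G0 : 0 < G by rewrite mulr_gt0// exprn_gt0.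
have QG : Q <= G.
  have -> : G = \int[lam]_(_ in D) (C ^+ 2) by rewrite Rintegral_cst.
  apply: le_Rintegral => //.
  - by apply: iD; exact: locbM.
  - by apply: iD; exact: locb_cst.
  - by move=> y /gC gy; rewrite -real_normK ?num_real// lerXn2r// nnegrE ltW.
(* The usual minimizer divides by the integral [Q] of [g ^+ 2], which may be zero; its upper bound
   [G] is positive and yields [t ^+ 2 * G <= F]. *)
pose t := I / G.
have : 0 <= \int[lam]_(y in D)
    (f y * f y + - (2 * t) * (f y * g y) + t ^+ 2 * (g y * g y)).
  apply: Rintegral_ge0 => y _.
  rewrite (_ : _ + _ = (f y - t * g y) ^+ 2) ?sqr_ge0//; ring.
rewrite RintegralD//; last 2 first.
- apply: iD; apply: locbD; first exact: locbM.
  by apply: locbM; [exact: locb_cst|exact: locbM].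
- by apply: iD; apply: locbM; [exact: locb_cst|exact: locbM].
rewrite RintegralD//; last 2 first.
- by apply: iD; exact: locbM.
- by apply: iD; apply: locbM; [exact: locb_cst|exact: locbM].
rewrite !RintegralZl//; last 2 first.
- by apply: iD; exact: locbM.
- by apply: iD; exact: locbM.
rewrite -/F -/I -/Q => H.
have tQ : t ^+ 2 * Q <= t ^+ 2 * G by rewrite ler_wpM2l ?sqr_ge0.
have IG : I = t * G by rewrite /t mulfVK// gt_eqF.
rewrite -/G IG; rewrite IG in H.
have : t ^+ 2 * G <= F by lra.
by move=> /(ler_wpM2l (ltW G0)); apply: le_trans; lra.
Qed.

Lemma number_varianceE N (x : 'I_N -> V) r :
  number_variance A x r = L^-1 * \int[lam]_(y in D)
    ((\sum_(j < N) ball_indicator A (x j) r y - N%:R * ball_volume A r) ^+ 2).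
Proof.
rewrite /number_variance /Rintegral.
have mD := measurable_fund_domain uA.
under eq_integral do under eq_bigr do rewrite ball_indicator_sym//.
set f := (X in _ = _ * fine (\int[_]_(y in _) (X y)%:E)%E).
have bf : locb f.
  have H : locb (fun y : V =>
      \sum_(j < N) ball_indicator A (x j) r y - N%:R * ball_volume A r).
    apply: locbD; last exact: locb_cst.
    by apply: locb_sum => j; exact: locb_ball_indicator.
  exact: (locbM H H).
rewrite ge0_integral_mscale//; last 2 first.
- by apply/measurable_EFinP/measurable_funTS; exact: bf.1.
- by move=> y _; rewrite lee_fin sqr_ge0.
rewrite fineM//; apply: integrable_fin_num => //.
exact: (integrable_fund_domain uA bf).
Qed.

(** The left side is the square of the discrepancy paired with [g], after unfolding each ball count.
    In the constant, one factor [L] comes from Cauchy-Schwarz and the other undoes the normalization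
    of the measure. *)
Lemma test_function_bound N (x : 'I_N -> V) r g C : locb g -> lat_periodic A g ->
  0 < C -> (forall y, D y -> `|g y| <= C) ->
  (\sum_(j < N) \int[lam]_(y in eball (x j) r) g y
    - N%:R * ball_volume A r * \int[lam]_(y in D) g y) ^+ 2 <=
  (C * L) ^+ 2 * number_variance A x r.
Proof.
move=> bg pg C0 gC; have L0 := fund_domain_gt0 uA.
have mD := measurable_fund_domain uA.
have iD h : locb h -> lam.-integrable D (EFin \o h) by exact: integrable_fund_domain.
pose f y := \sum_(j < N) ball_indicator A (x j) r y - N%:R * ball_volume A r.
have bb j : locb (fun y => ball_indicator A (x j) r y * g y).
  by apply: locbM => //; exact: locb_ball_indicator.
have bf : locb f.
  apply: locbD; last exact: locb_cst.
  by apply: locb_sum => j; exact: locb_ball_indicator.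
rewrite number_varianceE exprMn.
have -> : C ^+ 2 * L ^+ 2 * (L^-1 * \int[lam]_(y in D) (f y ^+ 2)) =
    C ^+ 2 * L * \int[lam]_(y in D) (f y ^+ 2) by field; rewrite gt_eqF.
suff <- : \int[lam]_(y in D) (f y * g y) =
    \sum_(j < N) \int[lam]_(y in eball (x j) r) g y
    - N%:R * ball_volume A r * \int[lam]_(y in D) g y.
  exact: cauchy_schwarz_fund_domain.
under eq_Rintegral do rewrite mulrBl mulr_suml.
rewrite RintegralB//; last 2 first.
- by apply: iD; exact: locb_sum.
- by apply: iD; apply: locbM => //; exact: locb_cst.
rewrite RintegralZl//; last exact: iD.
rewrite Rintegral_sum//; last by move=> j; exact: iD.
by congr (_ - _); apply: eq_bigr => j _; rewrite integral_ball_indicator.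
Qed.

End number_variance_bounds.

(** * Consequences of hyperuniformity: small defects and ball volumes *)

Section hyperuniform.
Context {R : realType} {d : nat} (A : 'M[R]_d).
Hypotheses (hd : (0 < d)%N) (uA : A \in unitmx).
Local Notation V := 'cV[R]_d.
Local Notation lam := (@lebesgue_cV R d).
Local Notation D := (fund_domain A).
Local Notation L := (fine (lam D)).
Implicit Types (f g : V -> R).

(** Ensures that admissible radii exist. The witnesses are the origin and half the sum of the
    generators, distinct because [d] is positive. *)
Lemma diam_gt0 : 0 < diam A.
Proof.
have [C C0 DC] := fund_domain_bounded A.
pose v : V := A *m const_mx (2^-1).
have Dv : D v.
  exists (const_mx 2^-1) => // j; rewrite mxE invr_ge0 ler0n /= invf_lt1//.
  by rewrite ltr1n.
have D0 : D 0.
  by exists 0; [move=> j; rewrite mxE lexx ltr01|rewrite mulmx0].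
apply: (@lt_le_trans _ _ (enorm (v - 0))).
  rewrite subr0 enorm_gt0//; apply/eqP => /(congr1 (mulmx (invmx A))).
  rewrite mulKmx// mulmx0 => /matrixP/(_ (Ordinal hd) ord0).
  by rewrite !mxE => /eqP; rewrite invr_eq0 pnatr_eq0.
apply: ub_le_sup; last by exists v => //; exists 0.
exists (C + C) => _ [x /DC /= xC] [y /DC /= yC] <-.
by rewrite (le_trans (enormD _ _))// enormN lerD.
Qed.

Variable X : @point_sequence R d.
Hypothesis hyp : hyperuniform_large_balls A X.

(** For periodic [g] this is the integral over [D] of the discrepancy times [g], in unfolded
    form. *)
Definition test_defect r g N :=
  \sum_(j < N) \int[lam]_(y in eball (X j) r) g y
    - N%:R * ball_volume A r * \int[lam]_(y in D) g y.

Lemma test_defect_sqr_small r g C e : 0 < r < diam A / 2 ->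
  locb g -> lat_periodic A g -> (forall y, D y -> `|g y| <= C) -> 0 < e ->
  \forall N \near \oo, test_defect r g N ^+ 2 <= e * N%:R.
Proof.
move=> hr bg pg gC e0.
pose C' := `|C| + 1; have C'0 : 0 < C' by rewrite ltr_wpDl.
have CC' y : D y -> `|g y| <= C'.
  by move=> /gC H; rewrite (le_trans H)// (le_trans (ler_norm C))// lerDl.
have L0 := fund_domain_gt0 uA.
have K0 : 0 < (C' * L) ^+ 2 by rewrite exprn_gt0// mulr_gt0.
(* The tolerance for the variance is chosen to cancel the constant of [test_function_bound]. *)
have /eqoP /(_ (e / (C' * L) ^+ 2)) := hyp hr.
rewrite divr_gt0// => /(_ isT); apply: filterS => N.
rewrite normr_nat => H.
apply: (le_trans (test_function_bound uA (@X N) r bg pg C'0 CC')).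
rewrite -ler_pdivlMl//; apply: le_trans (ler_norm _) _.
by apply: (le_trans H); rewrite mulrA [_^-1 * e]mulrC.
Qed.

Lemma test_defect_small r g C e : 0 < r < diam A / 2 ->
  locb g -> lat_periodic A g -> (forall y, D y -> `|g y| <= C) -> 0 < e ->
  \forall N \near \oo, `|test_defect r g N| <= e * N%:R.
Proof.
move=> hr bg pg gC e0.
have : \forall N \near \oo, test_defect r g N ^+ 2 <= e ^+ 2 * N%:R.
  by apply: test_defect_sqr_small gC _ => //; rewrite exprn_gt0.
apply: filterS => N H.
rewrite -ler_sqr ?nnegrE// ?mulr_ge0 ?ler0n ?(ltW e0)//.
rewrite real_normK ?num_real// (le_trans H)// exprMn ler_wpM2l ?sqr_ge0//.
(* Here [N <= N ^ 2], so the square-root growth is relaxed to linear growth, enough to compare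
   counts with volumes. *)
by rewrite expr2 -natrM ler_nat; case: N {H} => // N; rewrite leq_pmulr.
Qed.

(** The constant test function has defect exactly [N * c]; a bound by [N * |c| / 2] for large [N]
    forces [c = 0]. *)
Lemma measure_eball_small r : 0 < r < diam A / 2 ->
  fine (lam (eball 0 r)) = L * ball_volume A r.
Proof.
move=> hr; pose c := fine (lam (eball 0 r)) - L * ball_volume A r.
have TE N : test_defect r (cst 1) N = N%:R * c.
  rewrite /test_defect (Rintegral_cV_cst _ (measurable_fund_domain uA)) mul1r.
  under eq_bigr => j _.
    rewrite (Rintegral_cV_cst _ (measurable_eball _ _)) mul1r.
    rewrite (lebesgue_cV_eballE (X j)); over.
  by rewrite sumr_const card_ord /c mulrBr mulr_natl; ring.
apply/eqP; rewrite -subr_eq0; apply/negPn/negP => c0.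
have e0 : 0 < `|c| / 2 by rewrite divr_gt0// normr_gt0.
have [||N _ /(_ N.+1 (leqnSn N))] := @test_defect_small r (cst 1) 1 (`|c| / 2) hr
    (locb_cst 1) _ _ e0.
- by [].
- by move=> y _; rewrite normr1.
rewrite /= TE normrM normr_nat mulrC ler_pM2r ?ltr0n//.
have : 0 < `|c| by rewrite normr_gt0.
lra.
Qed.

(** Both sides are homogeneous of degree [d] in [r], so the admissible radius [diam A / 4] decides
    all of them. *)
Lemma measure_eball r : 0 < r -> fine (lam (eball 0 r)) = L * ball_volume A r.
Proof.
move=> r0; have d0 := diam_gt0.
pose s := diam A / 4; have s0 : 0 < s by rewrite divr_gt0.
have := @measure_eball_small s; rewrite s0 /= => /(_ _).
have -> : s < diam A / 2 by rewrite /s; lra.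
move=> /(_ isT).
have E t : 0 < t -> fine (lam (eball 0 t)) = t ^+ d * fine (lam (eball 0 1)).
  move=> t0; rewrite lebesgue_cV_eball_scale// fineM//.
  rewrite ge0_fin_numE//; apply: (@lebesgue_cV_bounded_lty _ _ _ 1).
    exact: measurable_eball.
  by move=> y; rewrite /eball /= subr0.
rewrite (E s)// (E r)// /ball_volume => H.
have sd : s ^+ d != 0 by rewrite expf_neq0// gt_eqF.
by apply: (mulfI sd); rewrite mulrCA H; ring.
Qed.

(** Positivity is inherited from the measure of the ball, without evaluating the Gamma integral. *)
Lemma ball_volume_gt0 r : 0 < r -> 0 < ball_volume A r.
Proof.
move=> r0; have L0 := fund_domain_gt0 uA.
rewrite -(pmulr_rgt0 _ L0) -measure_eball// fine_gt0//.
rewrite lebesgue_cV_eball_gt0//=.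
apply: (@lebesgue_cV_bounded_lty _ _ _ r); first exact: measurable_eball.
by move=> y; rewrite /eball /= subr0.
Qed.

Lemma integral_ball_indicator1 (x : V) r : 0 < r ->
  \int[lam]_(y in D) ball_indicator A x r y = L * ball_volume A r.
Proof.
move=> r0; rewrite -measure_eball// -(lebesgue_cV_eballE x).
have := @integral_ball_indicator R d A uA x r (cst 1) (locb_cst 1) (fun _ _ => erefl).
under eq_Rintegral do rewrite mulr1.
by move=> ->; rewrite (Rintegral_cV_cst _ (measurable_eball _ _)) mul1r.
Qed.

Lemma ball_indicator_le_shift (x y z : V) r s : enorm (y - z) <= s ->
  ball_indicator A x r z <= ball_indicator A x (r + s) y.
Proof.
move=> yz; have [t ut ct] := covers_exists uA
  (`|enorm x + enorm z + r| + `|enorm x + enorm y + (r + s)|).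
rewrite (@ball_indicatorE _ _ _ uA _ _ _ _ ut); last first.
  by apply: coversS ct; rewrite (le_trans (ler_norm _))// lerDl.
rewrite (@ball_indicatorE _ _ _ uA _ _ _ _ ut); last first.
  by apply: coversS ct; rewrite (le_trans (ler_norm _))// lerDr.
apply: ler_sum => m _; rewrite !eball_indicE ler_nat.
case: (boolP (enorm (z + lpt A m - x) <= r)) => // zr.
suff -> : (enorm (y + lpt A m - x) <= r + s)%R by [].
have -> : y + lpt A m - x = (z + lpt A m - x) + (y - z).
  rewrite addrAC [_ + (y - z)]addrC -!addrA; congr (_ + _).
  by rewrite !addrA addNr add0r addrC.
by rewrite (le_trans (enormD _ _))// lerD.
Qed.

(** Averages [ball_indicator_le_shift] over the ball about [z]: this smooths the count at a sample
    point into an integral of a test function. *)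
Lemma integral_ball_indicator_ge (x z : V) r s : 0 < s ->
  L * ball_volume A s * ball_indicator A x r z <=
  \int[lam]_(y in eball z s) ball_indicator A x (r + s) y.
Proof.
move=> s0; rewrite -measure_eball// -(lebesgue_cV_eballE z) mulrC.
rewrite -(Rintegral_cV_cst _ (measurable_eball _ _)).
have iz := integrable_locb (measurable_eball z s) (@eball_bounded _ _ z s).
apply: le_Rintegral.
- exact: measurable_eball.
- exact/iz/locb_cst.
- exact/iz/locb_ball_indicator.
- by move=> y yz; exact: ball_indicator_le_shift.
Qed.

Lemma integral_ball_indicator_le (x z : V) r s : 0 < s ->
  \int[lam]_(y in eball z s) ball_indicator A x (r - s) y <=
  L * ball_volume A s * ball_indicator A x r z.
Proof.
move=> s0; rewrite -measure_eball// -(lebesgue_cV_eballE z) mulrC.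
rewrite -(Rintegral_cV_cst _ (measurable_eball _ _)).
have iz := integrable_locb (measurable_eball z s) (@eball_bounded _ _ z s).
apply: le_Rintegral.
- exact: measurable_eball.
- exact/iz/locb_ball_indicator.
- exact/iz/locb_cst.
- move=> y yz; rewrite -[X in _ <= ball_indicator A x X z](subrK s).
  by apply: ball_indicator_le_shift; rewrite enormBC.
Qed.

End hyperuniform.

(** * Uniform distribution *)

Section equidistribution.
Context {R : realType} {d : nat} (A : 'M[R]_d).
Hypotheses (hd : (0 < d)%N) (uA : A \in unitmx).
Variable X : @point_sequence R d.
Hypothesis hyp : hyperuniform_large_balls A X.
Local Notation V := 'cV[R]_d.
Local Notation lam := (@lebesgue_cV R d).
Local Notation D := (fund_domain A).
Local Notation L := (fine (lam D)).

Lemma locb_bounded_fund_domain (g : V -> R) : locb g ->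
  exists C, forall y, D y -> `|g y| <= C.
Proof.
have [M _ DM] := fund_domain_bounded A; move=> [_ /(_ M)[C gC]].
by exists C => y /DM; exact: gC.
Qed.

Lemma ball_volume_near r e : 0 < e ->
  exists2 s : R, 0 < s < diam A / 2 &
    forall t, `|t - r| <= s -> `|ball_volume A t - ball_volume A r| <= e.
Proof.
move=> e0; have d0 := diam_gt0 hd uA.
pose k := (covolume A)^-1 * (pi `^ (d%:R / 2) / Gamma (d%:R / 2 + 1)).
have : (fun t : R => k * t ^+ d) @ r --> k * r ^+ d.
  by apply: cvgMl_tmp; exact: exprn_continuous.
move=> /cvgrPdist_le/(_ e e0)[s /= s0 Hs].
(* Halving [s] allows a closed condition on [t]; [diam A / 4] keeps the radius strictly
   admissible. *)
exists (Num.min (s / 2) (diam A / 4)).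
  rewrite lt_min !divr_gt0//= (@le_lt_trans _ _ (diam A / 4))//.
    by rewrite ge_min lexx orbT.
  lra.
move=> t tr; rewrite distrC; apply: Hs; rewrite /ball /= distrC.
apply: (le_lt_trans tr); apply: (@le_lt_trans _ _ (s / 2)); last lra.
by rewrite ge_min lexx.
Qed.

(** The count times the volume of the smoothing ball is at most the integral of the indicator of
    radius [r + s], summed over the sample. Half of [e] pays for enlarging the radius, half for the
    defect. *)
Lemma counting_upper (x : V) r e : 0 <= r -> 0 < e ->
  \forall N \near \oo,
    \sum_(j < N) ball_indicator A x r (X j) <= N%:R * (ball_volume A r + e).
Proof.
move=> r0 e0; have e20 : 0 < e / 2 by rewrite divr_gt0.
have [s hs Hs] := ball_volume_near r e20; have /andP[s0 _] := hs.
have L0 := fund_domain_gt0 uA; have v0 := ball_volume_gt0 hd uA hyp s0.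
pose g := ball_indicator A x (r + s).
have bg : locb g by exact: locb_ball_indicator.
have pg : lat_periodic A g by move=> y m; exact: ball_indicator_periodic.
have [C gC] := locb_bounded_fund_domain bg.
have Lv0 : 0 < L * ball_volume A s by rewrite mulr_gt0.
(* Proportional to the mass of the smoothing ball, so that [e / 2] remains after division by that
   mass. *)
have c0 : 0 < L * ball_volume A s * (e / 2) by rewrite mulr_gt0.
have := test_defect_small uA hyp hs bg pg gC c0; apply: filterS => N.
move=> /(le_trans (ler_norm _)); rewrite /test_defect.
rewrite (integral_ball_indicator1 hd uA hyp)//; last by rewrite ltr_wpDl.
set T := \sum_(j < N) Rintegral _ _ _ => HT.
have : L * ball_volume A s * \sum_(j < N) ball_indicator A x r (X j) <= T.
  rewrite mulr_sumr; apply: ler_sum => j _.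
  exact: (integral_ball_indicator_ge hd uA hyp).
move=> HS; rewrite -(ler_pM2l Lv0); apply: (le_trans HS).
have : ball_volume A (r + s) <= ball_volume A r + e / 2.
  have := Hs (r + s); rewrite addrAC subrr add0r gtr0_norm// lexx => /(_ isT).
  by rewrite ler_distl => /andP[_].
move=> /(ler_wpM2l (ltW Lv0)) /(ler_wpM2l (ler0n _ N)); nra.
Qed.

Lemma counting_lower (x : V) r e : 0 < r -> 0 < e ->
  \forall N \near \oo,
    N%:R * (ball_volume A r - e) <= \sum_(j < N) ball_indicator A x r (X j).
Proof.
move=> r0 e0; have e20 : 0 < e / 2 by rewrite divr_gt0.
have [s' /andP[s'0 s'd] Hs'] := ball_volume_near r e20.
(* Besides being admissible, [s] must stay below [r] for the inner radius [r - s] to be positive. *)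
pose s := Num.min s' (r / 2).
have s0 : 0 < s by rewrite lt_min s'0 divr_gt0.
have ss' : s <= s' by rewrite ge_min lexx.
have sr : s < r by apply: (@le_lt_trans _ _ (r / 2)); [rewrite ge_min lexx orbT|lra].
have hs : 0 < s < diam A / 2 by rewrite s0 (le_lt_trans ss').
have L0 := fund_domain_gt0 uA; have v0 := ball_volume_gt0 hd uA hyp s0.
pose g := ball_indicator A x (r - s).
have bg : locb g by exact: locb_ball_indicator.
have pg : lat_periodic A g by move=> y m; exact: ball_indicator_periodic.
have [C gC] := locb_bounded_fund_domain bg.
have Lv0 : 0 < L * ball_volume A s by rewrite mulr_gt0.
have c0 : 0 < L * ball_volume A s * (e / 2) by rewrite mulr_gt0.
have := test_defect_small uA hyp hs bg pg gC c0; apply: filterS => N.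
rewrite ler_norml => /andP[+ _]; rewrite /test_defect.
rewrite (integral_ball_indicator1 hd uA hyp)//; last by rewrite subr_gt0.
set T := \sum_(j < N) Rintegral _ _ _ => HT.
have : T <= L * ball_volume A s * \sum_(j < N) ball_indicator A x r (X j).
  rewrite mulr_sumr; apply: ler_sum => j _.
  exact: (integral_ball_indicator_le hd uA hyp).
move=> HS; rewrite -(ler_pM2l Lv0); apply: le_trans HS.
have : ball_volume A r - e / 2 <= ball_volume A (r - s).
  have := Hs' (r - s); rewrite addrAC subrr add0r normrN gtr0_norm// => /(_ ss').
  by rewrite ler_distl => /andP[].
move=> /(ler_wpM2l (ltW Lv0)) /(ler_wpM2l (ler0n _ N)); nra.
Qed.

Lemma hyperuniform_uniformly_distributed : uniformly_distributed A X.
Proof.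
move=> x r /andP[r0 _]; apply/cvgrPdist_le => e e0.
have low : \forall N \near \oo,
    N%:R * (ball_volume A r - e) <= \sum_(j < N) ball_indicator A x r (X j).
  (* At [r = 0] there is no inner ball, but the volume is zero because [d] is positive, and counts
     are nonnegative. *)
  move: r0; rewrite le_eqVlt => /predU1P[<-|r0]; last exact: counting_lower.
  apply: nearW => N; apply: (@le_trans _ _ 0); last first.
    by apply: sumr_ge0 => j _; exact: ball_indicator_ge0.
  rewrite /ball_volume expr0n gtn_eqF//= mulr0 sub0r mulrN oppr_le0.
  by rewrite mulr_ge0// ltW.
near=> N.
have N0 : 0 < N%:R :> R by rewrite ltr0n; near: N; exact: nbhs_infty_gt.
rewrite distrC ler_distl mulrC ler_pdivlMr// ler_pdivrMr// ![_ * N%:R]mulrC.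
apply/andP; split; near: N; first exact: low.
exact: counting_upper.
Unshelve. all: by end_near. Qed.

End equidistribution.

(** * Exponential sums *)

Lemma sum_Complex (R : rcfType) I (s : seq I) (f g : I -> R) :
  \sum_(i <- s) Complex (f i) (g i) = Complex (\sum_(i <- s) f i) (\sum_(i <- s) g i).
Proof. by elim: s => [|i s IH]; rewrite !(big_nil, big_cons)// IH. Qed.

Lemma sqr_sumE (R : comNzRingType) (I : finType) (f : I -> R) :
  (\sum_i f i) ^+ 2 = \sum_k \sum_j f j * f k.
Proof.
rewrite expr2 mulr_sumr; apply: eq_bigr => k _ /=.
by rewrite mulr_suml.
Qed.

Lemma Rintegral_eball_shift (R : realType) d (x : 'cV[R]_d) r (g : 'cV[R]_d -> R) :
  locb g -> \int[lebesgue_cV d]_(y in eball x r) g y =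
            \int[lebesgue_cV d]_(y in eball 0 r) g (y + x).
Proof.
move=> bg; have mx := measurable_eball x r; have m0 := measurable_eball (0 : 'cV[R]_d) r.
have E : (fun y => \1_(eball x r) (y + x) * g (y + x)) =
    (fun y => \1_(eball 0 r) y * g (y + x)).
  by apply/funext => y; rewrite !eball_indicE addrK subr0.
rewrite [LHS]Rintegral_indicM [RHS]Rintegral_indicM -E -(@Rintegral_cV_shift _ _ x)//.
  by apply: (locbM (locb_indic mx) bg).1.
rewrite E; apply: integrable_supp.
  by apply: locbM; [exact: locb_indic|exact: locb_shift].
exact: supp_indicM (@eball0_bounded _ _ _).
Qed.

Section exponential_sums.
Context {R : realType} {d : nat} (A : 'M[R]_d).
Hypotheses (hd : (0 < d)%N) (uA : A \in unitmx).
Variable X : @point_sequence R d.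
Hypothesis hyp : hyperuniform_large_balls A X.
Local Notation V := 'cV[R]_d.
Local Notation lam := (@lebesgue_cV R d).
Local Notation D := (fund_domain A).
Variable w : V.
Hypotheses (dw : dual_lattice A w) (w0 : w != 0).

Lemma periodic_2pi_int (f : R -> R) (a : R) (z : int) :
  periodic f (pi *+ 2) -> f (2 * pi * (a + z%:~R)) = f (2 * pi * a).
Proof.
move=> pf; have H b n : f (2 * pi * (b + n%:R)) = f (2 * pi * b).
  rewrite -[RHS](periodicn pf n); congr f.
  by rewrite -mulr_natr -[pi *+ 2]mulr_natr; ring.
case: z => n; first by rewrite -pmulrn H.
by rewrite NegzE mulrNz -(H _ n.+1) -pmulrn subrK.
Qed.

Lemma dual_periodic (f : R -> R) : periodic f (pi *+ 2) ->
  lat_periodic A (fun y => f (2 * pi * dot w y)).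
Proof.
move=> pf y m; rewrite dotDr.
have /dw/intrP[z ->] : lattice A (lpt A m) by exists m.
exact: periodic_2pi_int.
Qed.

Lemma locb_comp_dot (f : R -> R) : continuous f -> (forall t, `|f t| <= 1) ->
  locb (fun y : V => f (2 * pi * dot w y)).
Proof.
move=> cf f1; split; last by exists 1 => y _; exact: f1.
apply: measurableT_comp; first exact: continuous_measurable_fun.
by apply: measurable_funM => //; exact: measurable_fun_dot.
Qed.

Lemma integral_dual_zero (f : R -> R) : continuous f -> (forall t, `|f t| <= 1) ->
  periodic f (pi *+ 2) -> alternating f pi ->
  \int[lam]_(y in D) f (2 * pi * dot w y) = 0.
Proof.
move=> cf f1 pf af; have w00 := enorm_gt0 w0.
have ww : dot w w != 0 by rewrite -sqr_enorm expf_neq0// gt_eqF.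
(* Translation by [w / (2 <w,w>)] raises [<w,y>] by one half, hence the phase by [pi], which flips
   the sign of [f]. *)
apply: (@integral_antiperiodic _ _ _ uA ((2 * dot w w)^-1 *: w)).
- exact: locb_comp_dot.
- exact: dual_periodic.
- move=> y; rewrite dotDr dotZr -af; congr f.
  by field; rewrite ww.
Qed.

(** Recentring at the origin and the addition formula factor out the phase of the centre. The sine
    integral is carried along; with the companion formula for sine the result is a rotation and
    scaling. *)
Lemma integral_cos_eball (x : V) r :
  \int[lam]_(y in eball x r) cos (2 * pi * dot w y) =
  cos (2 * pi * dot w x) * \int[lam]_(y in eball 0 r) cos (2 * pi * dot w y) -
  sin (2 * pi * dot w x) * \int[lam]_(y in eball 0 r) sin (2 * pi * dot w y).
Proof.
have [mB BM] := (measurable_eball (0 : V) r, @eball0_bounded R d r).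
have lc := locb_comp_dot (@continuous_cos R) (@cos_max R).
have ls := locb_comp_dot (@continuous_sin R) (@sin_max R).
have [icos isin] := (integrable_locb mB BM lc, integrable_locb mB BM ls).
have iZ c := integrable_locb mB BM (locbM (locb_cst c) lc).
have iZ' c := integrable_locb mB BM (locbM (locb_cst c) ls).
rewrite -!RintegralZl// -RintegralB//.
rewrite Rintegral_eball_shift//.
by apply: eq_Rintegral => y _; rewrite dotDr mulrDr cosD; ring.
Qed.

Lemma integral_sin_eball (x : V) r :
  \int[lam]_(y in eball x r) sin (2 * pi * dot w y) =
  sin (2 * pi * dot w x) * \int[lam]_(y in eball 0 r) cos (2 * pi * dot w y) +
  cos (2 * pi * dot w x) * \int[lam]_(y in eball 0 r) sin (2 * pi * dot w y).
Proof.
have [mB BM] := (measurable_eball (0 : V) r, @eball0_bounded R d r).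
have lc := locb_comp_dot (@continuous_cos R) (@cos_max R).
have ls := locb_comp_dot (@continuous_sin R) (@sin_max R).
have [icos isin] := (integrable_locb mB BM lc, integrable_locb mB BM ls).
have iZ c := integrable_locb mB BM (locbM (locb_cst c) lc).
have iZ' c := integrable_locb mB BM (locbM (locb_cst c) ls).
rewrite -!RintegralZl// -RintegralD//.
rewrite Rintegral_eball_shift//.
by apply: eq_Rintegral => y _; rewrite dotDr mulrDr sinD; ring.
Qed.

Lemma integral_cos_eball_gt0 : exists2 r, 0 < r < diam A / 2 &
  0 < \int[lam]_(y in eball 0 r) cos (2 * pi * dot w y).
Proof.
have d0 := diam_gt0 hd uA; have w00 := enorm_gt0 w0.
have : cos t @[t --> (0 : R)] --> cos (0 : R) by exact: continuous_cos.
move=> /cvgrPdist_le/(_ (2^-1)); rewrite invr_gt0 ltr0n => /(_ isT)[s /= s0 Hs].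
pose q := 2 * pi * enorm w.
have q0 : 0 < q by rewrite !mulr_gt0// pi_gt0.
(* On the ball of radius [r] the phase is at most [q * r <= s / 2], so the cosine stays above one
   half. *)
pose r := Num.min (s / 2 / q) (diam A / 4).
have r0 : 0 < r by rewrite lt_min !divr_gt0.
exists r.
  rewrite r0 /= (@le_lt_trans _ _ (diam A / 4))//; first by rewrite ge_min lexx orbT.
  lra.
have mB : measurable (eball (0 : V) r) by exact: measurable_eball.
have BM : eball (0 : V) r `<=` [set v | enorm v <= r].
  by move=> y; rewrite /eball /= subr0.
have B0 : 0 < fine (lam (eball 0 r)).
  by rewrite fine_gt0// lebesgue_cV_eball_gt0//= (lebesgue_cV_bounded_lty mB BM).
apply: (@lt_le_trans _ _ (2^-1 * fine (lam (eball 0 r)))); first by rewrite mulr_gt0.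
rewrite -(Rintegral_cV_cst _ mB); apply: le_Rintegral => //.
- exact: (integrable_locb mB BM (locb_cst _)).
- apply: (integrable_locb mB BM).
  by apply: locb_comp_dot; [exact: continuous_cos|exact: cos_max].
move=> y /BM /= yr.
have : `|cos 0 - cos (2 * pi * dot w y)| <= 2^-1.
  apply: Hs; rewrite /ball /= sub0r normrN normrM gtr0_norm ?mulr_gt0 ?pi_gt0//.
  have wy : `|dot w y| <= enorm w * enorm y.
    rewrite ler_norml dot_le_enorm andbT lerNl -dotNl.
    by rewrite (le_trans (dot_le_enorm _ _))// enormN.
  apply: (@le_lt_trans _ _ (q * r)).
    rewrite /q -mulrA ler_wpM2l ?mulr_ge0 ?pi_ge0// (le_trans wy)//.
    by rewrite ler_wpM2l// ltW.
  apply: (@le_lt_trans _ _ (s / 2)); last lra.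
  by rewrite mulrC -ler_pdivlMr// /r ge_min lexx.
by rewrite cos0 ler_distlC => /andP[+ _]; lra.
Qed.

(** The cosine and sine defects are the real and imaginary parts of [(a + ib)(C + iS)]. Their
    squares add up to [(a ^+ 2 + b ^+ 2) * (C ^+ 2 + S ^+ 2)], and [a > 0] allows division; each
    defect receives half of the tolerance. *)
Lemma exponential_sum_small e : 0 < e -> \forall N \near \oo,
  (\sum_(j < N) cos (2 * pi * dot w (X j))) ^+ 2 +
  (\sum_(j < N) sin (2 * pi * dot w (X j))) ^+ 2 <= e * N%:R.
Proof.
move=> e0; have [r hr] := integral_cos_eball_gt0.
set a := Rintegral _ _ _ => a0.
pose b := \int[lam]_(y in eball 0 r) sin (2 * pi * dot w y).
pose C N := \sum_(j < N) cos (2 * pi * dot w (X j)).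
pose S N := \sum_(j < N) sin (2 * pi * dot w (X j)).
have cE N : test_defect A X r (fun y => cos (2 * pi * dot w y)) N = a * C N - b * S N.
  rewrite /test_defect integral_dual_zero ?mulr0 ?subr0; last 4 first.
  - exact: continuous_cos.
  - exact: cos_max.
  - exact: cosD2pi.
  - exact: cosDpi.
  rewrite !mulr_sumr -sumrB; apply: eq_bigr => j _.
  by rewrite integral_cos_eball -/a -/b; ring.
have sE N : test_defect A X r (fun y => sin (2 * pi * dot w y)) N = a * S N + b * C N.
  rewrite /test_defect integral_dual_zero ?mulr0 ?subr0; last 4 first.
  - exact: continuous_sin.
  - exact: sin_max.
  - exact: sinD2pi.
  - exact: sinDpi.
  rewrite !mulr_sumr -big_split; apply: eq_bigr => j _.
  by rewrite integral_sin_eball -/a -/b /=; ring.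
have k0 : 0 < a ^+ 2 + b ^+ 2 by rewrite ltr_pwDl ?exprn_gt0 ?sqr_ge0.
have ek : 0 < e * (a ^+ 2 + b ^+ 2) / 2 by rewrite !mulr_gt0.
have Hc := test_defect_sqr_small uA hyp hr
  (locb_comp_dot (@continuous_cos R) (@cos_max R)) (dual_periodic (@cosD2pi R))
  (fun y _ => cos_max _) ek.
have Hs := test_defect_sqr_small uA hyp hr
  (locb_comp_dot (@continuous_sin R) (@sin_max R)) (dual_periodic (@sinD2pi R))
  (fun y _ => sin_max _) ek.
near=> N; rewrite -/(C N) -/(S N) -(ler_pM2l k0).
have : test_defect A X r (fun y => cos (2 * pi * dot w y)) N ^+ 2 <=
    e * (a ^+ 2 + b ^+ 2) / 2 * N%:R by near: N.
have : test_defect A X r (fun y => sin (2 * pi * dot w y)) N ^+ 2 <=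
    e * (a ^+ 2 + b ^+ 2) / 2 * N%:R by near: N.
rewrite cE sE => H1 H2.
have -> : (a ^+ 2 + b ^+ 2) * (C N ^+ 2 + S N ^+ 2) =
    (a * C N - b * S N) ^+ 2 + (a * S N + b * C N) ^+ 2 by ring.
by apply: (le_trans (lerD H2 H1)); lra.
Unshelve. all: by end_near. Qed.

Lemma sum_expi2piE N (x : 'I_N -> V) :
  \sum_(k < N) \sum_(j < N) expi2pi (dot w (x j - x k)) =
  Complex ((\sum_(j < N) cos (2 * pi * dot w (x j))) ^+ 2 +
    (\sum_(j < N) sin (2 * pi * dot w (x j))) ^+ 2) 0.
Proof.
rewrite /expi2pi; under eq_bigr do rewrite sum_Complex.
rewrite sum_Complex; congr Complex.
  rewrite !sqr_sumE -big_split; apply: eq_bigr => k _ /=.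
  rewrite -big_split; apply: eq_bigr => j _ /=.
  by rewrite dotDr dotNr mulrBr cosB.
under eq_bigr => k _.
  under eq_bigr do rewrite dotDr dotNr mulrBr sinB.
  rewrite sumrB; over.
(* The imaginary part is antisymmetric in [j] and [k], so exchanging the sums cancels it. *)
rewrite sumrB [X in _ - X]exchange_big /=; apply/eqP; rewrite subr_eq0; apply/eqP.
by apply: eq_bigr => k _; apply: eq_bigr => j _; rewrite mulrC.
Qed.

Lemma exponential_sum_cvg :
  (fun N : nat => (N%:R^-1 * \sum_(k < N) \sum_(j < N)
     expi2pi (dot w (X j - X k)) : (R[i])^o)) @ \oo --> (0 : (R[i])^o).
Proof.
apply/cvgr0Pnorm_le => e e0.
(* In the partial order on [R[i]], a positive number is real, so the estimate reduces to one over
   [R]. *)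
have [er ei] : 0 < complex.Re e /\ complex.Im e = 0.
  by move: e0; case: e => a b; rewrite ltcE /= => /andP[/eqP H1 H2]; split.
near=> N.
have N0 : 0 < N%:R :> R by rewrite ltr0n; near: N; exact: nbhs_infty_gt.
rewrite sum_expi2piE.
set t := (X in Complex X 0).
have t0 : 0 <= t by rewrite addr_ge0 ?sqr_ge0.
have te : t <= complex.Re e * N%:R by rewrite /t; near: N; exact: exponential_sum_small.
have -> : (N%:R^-1 * Complex t 0 : R[i]) = (N%:R^-1 * t)%:C%C.
  by rewrite rmorphM fmorphV rmorph_nat.
rewrite normc_def /= expr0n addr0 sqrtr_sqr lecE /= ei eqxx /=.
by rewrite ger0_norm ?mulr_ge0 ?invr_ge0 ?ler0n// mulrC ler_pdivrMr.
Unshelve. all: by end_near. Qed.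

End exponential_sums.

Theorem theorem3p1 (R : realType) (d : nat) (hd : (0 < d)%N)
    (A : 'M[R]_d) (hA : A \in unitmx)
    (X : @point_sequence R d) (hX : point_sets A X)
    (hyp : hyperuniform_large_balls A X) :
  (forall w : 'cV[R]_d, dual_lattice A w -> w != 0 ->
     (fun N : nat => (N%:R^-1 * \sum_(k < N) \sum_(j < N)
        expi2pi (dot w (X N j - X N k)) : (R[i])^o)) @ \oo --> (0 : (R[i])^o))
  /\ uniformly_distributed A X.
Proof.
split; last exact: hyperuniform_uniformly_distributed.
by move=> w dw w0; exact: (exponential_sum_cvg hd hA hyp dw w0).
Qed.
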